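(* There is an absolute constant $C>0$ such that the following holds for every finite field $\mathbb{F}_q$, every degree $d$, every $m\ge 2$ and every $\epsilon_0\in(0,1)$ with $\epsilon_0\ge C\,(d/q)^{1/48}$. For every $\epsilon\ge\epsilon_0$, if a points table $f:\mathbb{F}_q^m\to\mathbb{F}_q$ and a degree-$d$ lines oracle $\ell\mapsto P_\ell$ satisfy $$\Pr_{\mathbf{x}\in\mathbb{F}_q^m,\ \ell\ni\mathbf{x}}[f(\mathbf{x})=P_\ell(\mathbf{x})]\ge 5\epsilon,$$ then there exists an $m$-variate polynomial $Q$ of total degree at most $d$ with $\Pr_{\mathbf{x}}[f(\mathbf{x})=Q(\mathbf{x})]\ge\epsilon^2$.
   Context: An (affine) line in $\mathbb{F}_q^m$ is a set $\ell=\{\mathbf{a}+t\mathbf{u}:t\in\mathbb{F}_q\}$ with $\mathbf{u}\neq 0$; a degree-$d$ polynomial on $\ell$ is a function on $\ell$ given, under a parametrization, by a univariate polynomial of degree at most $d$ in $t$. A degree-$d$ lines oracle assigns to every line $\ell$ a degree-$d$ polynomial $P_\ell$ on $\ell$. In probabilities, $\mathbf{x}$ is uniform and $\ell\ni\mathbf{x}$ is a uniformly random line through $\mathbf{x}$. *)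

(* Defs.v *)
From HB Require Import structures.
From mathcomp Require Import all_boot all_order all_algebra.
From mathcomp Require Import mpoly.
Set Implicit Arguments. Unset Strict Implicit. Unset Printing Implicit Defensive.
Import Order.TTheory GRing.Theory Num.Theory.
Local Open Scope ring_scope.

Section LinesDefs.
Variables (F : finFieldType) (m : nat).
Local Notation pt := 'rV[F]_m.

Definition line (a u : pt) : {set pt} := [set a + t *: u | t : F].

Definition is_line (L : {set pt}) : bool :=
  [exists a : pt, exists u : pt, (u != 0) && (L == line a u)].

Definition lines : {set {set pt}} := [set L | is_line L].

Definition lines_through (x : pt) : {set {set pt}} :=
  [set L in lines | x \in L].

(* A degree-d lines oracle: to every line L a function P L on L which,
   under a parametrization t |-> a + t u of L, is a univariate polynomial
   of degree at most d in t.  (Values of P L outside L are irrelevant.) *)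
Definition is_lines_oracle (d : nat) (P : {set pt} -> pt -> F) : Prop :=
  forall L, is_line L ->
    exists a u : pt, exists p : {poly F},
      [/\ u != 0, L = line a u, (size p <= d.+1)%N &
          forall t : F, P L (a + t *: u) = p.[t]].

Definition agreement (R : numFieldType) (f : pt -> F) (P : {set pt} -> pt -> F)
  : R :=
  (#|[set: pt]|%:R)^-1 *
  \sum_(x : pt) (#|lines_through x|%:R)^-1 *
     \sum_(L in lines_through x) (f x == P L x)%:R.

Definition mpeval (Q : {mpoly F[m]}) (x : pt) : F := Q.@[fun i => x ord0 i].

Definition tdeg_le (d : nat) (Q : {mpoly F[m]}) : bool := (msize Q <= d.+1)%N.

Definition pt_agreement (R : numFieldType) (f : pt -> F) (Q : {mpoly F[m]}) : R :=
  #|[set x : pt | f x == mpeval Q x]|%:R / #|[set: pt]|%:R.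

End LinesDefs.

(* Main.v *)
(** Lines are parametrised as [t |-> x + t u] with (x, u) uniform in V * V.

    In a plane, prune the point-line incidences on which f and the oracle agree
    to a core of large minimum degree, and take a nonzero A(Z, X, Y) of least
    degree vanishing on the graph of f over the core, with restrictions to lines
    of degree below the line degrees of the core. Then A vanishes on the graph
    of the oracle's polynomial on every core line. Minimality, the chain rule
    along core lines and p-th roots in characteristic p provide a core point at
    which f is a simple root of A in Z; Hensel lifting there produces one
    bivariate polynomial of degree at most d that restricts to the oracle's
    polynomial on all core lines through that point.

    In dimension m, list decoding in planes shows that for a typical base point
    the oracle's polynomials along the lines through it that agree with f there
    form a partial function that, on most planes, nearly coincides with a
    bivariate polynomial. Taking best fits on lines turns it into a total
    function passing the line test with probability close to 1. Correcting the
    latter along planes through an arbitrary point, then along planes through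
    an arbitrary line, gives a function of degree at most d on every line,
    hence a polynomial of total degree at most d. *)
Require Import Defs.
From HB Require Import structures.
From mathcomp Require Import all_boot all_order all_algebra.
From mathcomp Require Import ring lra zify.
From mathcomp Require Import mpoly finfield.
From mathcomp Require Import boolp reals exp.
Set Implicit Arguments. Unset Strict Implicit. Unset Printing Implicit Defensive.
Import Order.TTheory GRing.Theory Num.Theory.
Local Open Scope ring_scope.

(** * Polynomials and substitution *)

Section MpolyInduction.
Variables (K : comNzRingType) (n : nat).

Lemma mpoly_ring_ind (Pr : {mpoly K[n]} -> Prop) :
  (forall c, Pr c%:MP) -> (forall i, Pr 'X_i) ->
  (forall p q, Pr p -> Pr q -> Pr (p + q)) ->
  (forall p q, Pr p -> Pr q -> Pr (p * q)) -> forall p, Pr p.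
Proof.
move=> PrC PrX PrD PrM; elim/mpolyind => [|c m p _ _ Pr_p]; first exact: PrC.
apply: PrD => //; rewrite -mul_mpolyC; apply: (PrM); first exact: PrC.
rewrite mpolyXE_id; apply: (big_ind Pr) => [|x y Pr_x Pr_y|i _].
- exact: PrC.
- exact: PrM.
- by elim: (m i) => [|k IH]; [rewrite expr0; exact: PrC | rewrite exprS; exact: PrM].
Qed.

End MpolyInduction.

Section MultinomMeasure.
Variables (n : nat) (mf : measure n).

Lemma mfMn (m : 'X_{1..n}) k : mf (m *+ k)%MM = (mf m * k)%N.
Proof.
rewrite mfE [mf m]mfE big_distrl; apply: eq_bigr => i _.
by rewrite mulmnE mulnAC.
Qed.

Definition weight (w : 'I_n -> nat) (m : 'X_{1..n}) : nat := \sum_i m i * w i.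

Lemma weight0 w : weight w 0%MM = 0%N.
Proof. by rewrite /weight big1 // => i _; rewrite mnm0E. Qed.

Lemma weightD w : {morph weight w : m m' / (m + m')%MM >-> (m + m')%N}.
Proof.
by move=> m m'; rewrite /weight -big_split; apply: eq_bigr => i _; rewrite mnmDE mulnDl.
Qed.

HB.instance Definition _ w := isMeasure.Build n (weight w) (weight0 w) (weightD w).

Lemma weight1 w i : weight w U_(i)%MM = w i.
Proof.
rewrite /weight (bigD1 i) //= mnm1E eqxx mul1n big1 ?addn0 // => j ji.
by rewrite mnm1E eq_sym (negbTE ji).
Qed.

End MultinomMeasure.

Notation subst_poly h A := (mmap (@polyC _) h A).

Section Substitution.
Variables (F : fieldType) (n : nat).
Implicit Types (A : {mpoly F[n]}) (h : 'I_n -> {poly F}).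

Lemma horner_subst_poly h A t :
  (subst_poly h A).[t] = A.@[fun i => (h i).[t]].
Proof.
elim/mpoly_ring_ind: A => [c|i|p q IHp IHq|p q IHp IHq].
- by rewrite mmapC mevalC hornerC.
- by rewrite mmapX mmap1U mevalXU.
- by rewrite !rmorphD hornerD IHp IHq.
- by rewrite !rmorphM hornerM IHp IHq.
Qed.

Lemma size_subst_poly (mf : measure n) h A :
  (forall i, (size (h i) <= (mf U_(i)%MM).+1)%N) ->
  (size (subst_poly h A) <= mmeasure mf A)%N.
Proof.
move=> size_h; rewrite /mmap big_seq; apply: (leq_trans (size_sum _ _ _)).
apply/bigmax_leqP_seq => m mA _; apply: leq_trans (mmeasure_mnm_lt mf mA).
rewrite mul_polyC (leq_trans (size_scale_leq _ _)) // mfE.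
apply: (big_ind2 (fun (p : {poly F}) a => (size p <= a.+1)%N))
  => [|p a r b size_p size_r|i _].
- by rewrite size_poly1.
- apply: (leq_trans (size_polyMleq _ _)); move: size_p size_r.
  by case: (size p) (size r) => [|x] [|y] /=; lia.
- apply: (leq_trans (size_poly_exp_leq _ _)); rewrite ltnS mulnC leq_mul2l.
  by move: (size_h i); case: (size (h i)) => [|x] /=; rewrite ?orbT // ltnS => ->;
    rewrite orbT.
Qed.

Lemma mderivXU i j : ('X_i : {mpoly F[n]})^`M(j) = (i == j)%:R.
Proof.
rewrite mderivX mnm1E; have [<-|_] := eqVneq i j; last by rewrite scale0r.
rewrite scale1r (_ : (U_(i) - U_(i) = 0)%MM) ?mpolyX0 //.
by apply/mnmP => k; rewrite mnmBE mnm0E subnn.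
Qed.

Lemma deriv_subst_poly h A :
  (subst_poly h A)^`() = \sum_i subst_poly h A^`M(i) * (h i)^`().
Proof.
elim/mpoly_ring_ind: A => [c|i|p q IHp IHq|p q IHp IHq].
- rewrite mmapC derivC big1 // => i _.
  by rewrite mderivC mmap0 mul0r.
- rewrite mmapX mmap1U (bigD1 i) //= mderivXU eqxx rmorph1 mul1r.
  rewrite big1 ?addr0 // => j ji.
  by rewrite mderivXU eq_sym (negbTE ji) mmap0 mul0r.
- rewrite rmorphD derivD IHp IHq -big_split /=; apply: eq_bigr => i _.
  by rewrite mderivD rmorphD mulrDl.
- rewrite rmorphM derivM IHp IHq mulr_suml mulr_sumr -big_split /=.
  apply: eq_bigr => i _; rewrite mderivM rmorphD !rmorphM /=; ring.
Qed.

Lemma subst_poly_taylor h h' A (j : 'I_n) (e : {poly F}) :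
  h' j = h j + e -> (forall i, i != j -> h' i = h i) ->
  exists c, subst_poly h' A =
    subst_poly h A + e * subst_poly h A^`M(j) + e ^+ 2 * c.
Proof.
move=> h'j h'i; elim/mpoly_ring_ind: A => [c|i|p q [c IHp] [c' IHq]|p q [c IHp] [c' IHq]].
- by exists 0; rewrite !mmapC mderivC mmap0 !mulr0 !addr0.
- exists 0; rewrite !mmapX !mmap1U mderivXU mulr0 addr0.
  have [->|ij] := eqVneq i j; first by rewrite rmorph1 mulr1.
  by rewrite h'i // mmap0 mulr0 addr0.
- by exists (c + c'); rewrite mderivD !rmorphD /= IHp IHq; ring.
- exists (subst_poly h p * c' + c * subst_poly h q
     + subst_poly h p^`M(j) * subst_poly h q^`M(j)
     + e * (subst_poly h p^`M(j) * c' + c * subst_poly h q^`M(j))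
     + e ^+ 2 * (c * c')).
  by rewrite mderivM !rmorphD !rmorphM /= IHp IHq; ring.
Qed.

Lemma subst_poly_comp k h (g : 'I_k -> {mpoly F[n]}) (A : {mpoly F[k]}) :
  subst_poly h (mmap (@mpolyC n F) g A) = subst_poly (fun i => subst_poly h (g i)) A.
Proof.
elim/mpoly_ring_ind: A => [c|i|p q IHp IHq|p q IHp IHq].
- by rewrite !mmapC.
- by rewrite !mmapX !mmap1U.
- by rewrite !rmorphD /= IHp IHq.
- by rewrite !rmorphM /= IHp IHq.
Qed.

Lemma eq_subst_poly h h' A : h =1 h' -> subst_poly h A = subst_poly h' A.
Proof.
by move=> eq_h; apply: eq_bigr => m _; congr (_ * _); apply: mmap1_eq.
Qed.

End Substitution.

Lemma msizeM_leq (F : fieldType) n (p q : {mpoly F[n]}) a b :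
  (msize p <= a.+1)%N -> (msize q <= b.+1)%N -> (msize (p * q) <= (a + b).+1)%N.
Proof.
have [->|p0] := eqVneq p 0; first by rewrite mul0r msize0.
have [->|q0] := eqVneq q 0; first by rewrite mulr0 msize0.
by rewrite msizeM //; move: (msize p) (msize q) => k l; lia.
Qed.

Section LineParametrization.
Variables (F : fieldType) (n : nat).
Implicit Types (x u : 'rV[F]_n).

Definition line_param x u (i : 'I_n) : {poly F} := (x 0 i)%:P + u 0 i *: 'X.

Lemma size_affine_poly (a b : F) : (size (a%:P + b *: 'X)%R <= 2)%N.
Proof.
apply: (leq_trans (size_polyD _ _));
  rewrite geq_max size_polyC (leq_trans (leq_b1 _)) //=.
by rewrite (leq_trans (size_scale_leq _ _)) // size_polyX.
Qed.

Lemma horner_line_param x u i t : (line_param x u i).[t] = (x + t *: u) 0 i.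
Proof. by rewrite /line_param !hornerE !mxE mulrC. Qed.

Lemma horner_subst_line x u (B : {mpoly F[n]}) t :
  (subst_poly (line_param x u) B).[t] = B.@[(x + t *: u) 0].
Proof. by rewrite horner_subst_poly; apply: meval_eq => i; rewrite horner_line_param. Qed.

Lemma size_subst_line x u (B : {mpoly F[n]}) :
  (size (subst_poly (line_param x u) B) <= msize B)%N.
Proof. by apply: size_subst_poly => i; rewrite /= mdeg1 size_affine_poly. Qed.

Lemma taylor_parts x (B : {mpoly F[n]}) :
  exists G : nat -> {mpoly F[n]}, forall k, (msize (G k) <= k.+1)%N /\
    forall u, subst_poly (line_param x u) (G k) =
      (subst_poly (line_param x u) B)`_k *: 'X^k.
Proof.
elim/mpoly_ring_ind: B =>
  [c|i|p q [G taylorG] [G' taylorG']|p q [G taylorG] [G' taylorG']].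
- exists (fun k => if k is 0 then c%:MP else 0) => -[|k]; split=> [|u].
  + by rewrite mmeasureC leq_b1.
  + by rewrite !mmapC coefC /= expr0 alg_polyC.
  + by rewrite msize0.
  + by rewrite mmap0 mmapC coefC scale0r.
- exists (fun k => match k with 0 => (x 0 i)%:MP
            | 1 => 'X_i - (x 0 i)%:MP | _ => 0 end) => -[|[|k]]; split=> [|u].
  + by rewrite mmeasureC leq_b1.
  + rewrite mmapC mmapX mmap1U /line_param coefD coefC coefZ coefX /=.
    by rewrite mulr0 addr0 expr0 alg_polyC.
  + apply: (leq_trans (mmeasureD_le _ _ _)); rewrite geq_max mmeasureN mmeasureC.
    by rewrite msizeX mdeg1 (leq_trans (leq_b1 _)).
  + rewrite rmorphB /= mmapC mmapX mmap1U /line_param coefD coefC coefZ coefX /=.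
    by rewrite add0r mulr1 expr1 addrC addKr.
  + by rewrite msize0.
  + rewrite mmap0 mmapX mmap1U /line_param coefD coefC coefZ coefX /=.
    by rewrite mulr0 addr0 scale0r.
- exists (fun k => G k + G' k) => k.
  have [sizeG substG] := taylorG k; have [sizeG' substG'] := taylorG' k.
  split=> [|u]; last by rewrite !rmorphD /= substG substG' coefD scalerDl.
  by apply: (leq_trans (mmeasureD_le _ _ _)); rewrite geq_max sizeG sizeG'.
- exists (fun k => \sum_(j < k.+1) G j * G' (k - j)%N) => k; split=> [|u].
    apply: (leq_trans (mmeasure_sum _ _ _ _)); apply/bigmax_leqP => j _.
    apply: leq_trans (msizeM_leq (taylorG j).1 (taylorG' (k - j)%N).1) _.
    by rewrite subnKC // -ltnS.
  rewrite rmorph_sum rmorphM /= coefM scaler_suml; apply: eq_bigr => j _.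
  rewrite rmorphM /= (taylorG j).2 (taylorG' (k - j)%N).2.
  by rewrite -scalerAl -scalerAr scalerA -exprD subnKC // -ltnS.
Qed.

End LineParametrization.

Section FunctionCons.
Variables (n : nat) (T : Type).

Definition fcons (z : T) (v : 'I_n -> T) (i : 'I_n.+1) : T :=
  if unlift ord0 i is Some j then v j else z.

Lemma fcons0 z v : fcons z v ord0 = z.
Proof. by rewrite /fcons unlift_none. Qed.

Lemma fconsS z v j : fcons z v (lift ord0 j) = v j.
Proof. by rewrite /fcons liftK. Qed.

End FunctionCons.

Lemma fcons_comp n (T T' : Type) (g : T -> T') z (v : 'I_n -> T) i :
  g (fcons z v i) = fcons (g z) (g \o v) i.
Proof. by case: (unliftP ord0 i) => [j|] ->; rewrite ?fconsS ?fcons0. Qed.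

Lemma eq_fcons n (T : Type) z (v v' : 'I_n -> T) : v =1 v' -> fcons z v =1 fcons z v'.
Proof. by move=> eq_v i; case: (unliftP ord0 i) => [j|] ->; rewrite ?fconsS ?fcons0. Qed.

(* Variable [ord0] of [A] is the value coordinate of the graph of a function. *)
Section Graph.
Variables (F : fieldType) (n : nat).
Implicit Types (x u : 'rV[F]_n) (A : {mpoly F[n.+1]}) (p r : {poly F}).

Lemma horner_subst_graph x u p A t :
  (subst_poly (fcons p (line_param x u)) A).[t] = A.@[fcons p.[t] ((x + t *: u) 0)].
Proof.
rewrite horner_subst_poly; apply: meval_eq => i.
rewrite (fcons_comp (fun r => r.[t])); apply: eq_fcons => j /=.
exact: horner_line_param.
Qed.

Lemma newton_coef (h : 'I_n -> {poly F}) A p r N :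
  (forall i, (i <= N)%N -> p`_i = r`_i) -> subst_poly (fcons p h) A = 0 ->
  (subst_poly (fcons r h) A)`_N.+1 +
    (p`_N.+1 - r`_N.+1) * (subst_poly (fcons r h) A^`M(ord0)).[0] = 0.
Proof.
move=> eq_pr root_p.
pose s := drop_poly N.+1 (p - r).
have def_pr : p - r = s * 'X^(N.+1).
  rewrite -[LHS](poly_take_drop N.+1) -/s (_ : take_poly _ _ = 0) ?add0r //.
  apply/polyP => k; rewrite coef_take_poly coef0; case: ltnP => // kN.
  by rewrite coefB eq_pr ?subrr.
have [||c taylor] := @subst_poly_taylor F n.+1 (fcons r h) (fcons p h) A ord0 (p - r).
- by rewrite !fcons0 addrC subrK.
- by move=> i; case: (unliftP ord0 i) => [j ->|->]; rewrite ?eqxx // !fconsS.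
rewrite root_p def_pr in taylor; rewrite -coefB def_pr.
have -> : (s * 'X^(N.+1))`_N.+1 = s.[0] by rewrite coefMXn ltnn subnn horner_coef0.
have := congr1 (fun q : {poly F} => q`_N.+1) taylor.
rewrite /= coef0 !coefD -mulrA mulrCA coefXnM ltnn subnn coef0M -!horner_coef0.
have -> : (s * 'X^(N.+1)) ^+ 2 * c = 'X^(N.+1 + N.+1) * (s ^+ 2 * c).
  by rewrite exprD; ring.
by rewrite coefXnM addSn ltnS leq_addl addr0 => <-.
Qed.

(* Hensel lifting: the branch through a simple root z of A(x, Z) is determined,
   degree by degree, by polynomials in the direction. *)
Lemma hensel_lines x z A (N : nat) : A^`M(ord0).@[fcons z (x 0)] != 0 ->
  exists2 Q : {mpoly F[n]}, (msize Q <= N.+1)%N &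
    forall u p, p.[0] = z -> subst_poly (fcons p (line_param x u)) A = 0 ->
    forall i, (i <= N)%N -> p`_i = (subst_poly (line_param x u) Q)`_i.
Proof.
set c := A^`M(ord0).@[_] => c0; elim: N => [|N [Q sizeQ branchQ]].
  exists z%:MP; first by rewrite mmeasureC leq_b1.
  move=> u p pz _ [|i] // _; rewrite mmapC coefC eqxx.
  by rewrite -horner_coef0.
have [G taylorG] := taylor_parts x (mmap (@mpolyC n F) (fcons Q (fun j => 'X_j)) A).
have [sizeG substG] := taylorG N.+1.
exists (Q - c^-1 *: G N.+1).
  apply: (leq_trans (mmeasureD_le _ _ _)); rewrite geq_max mmeasureN.
  by rewrite (leq_trans sizeQ) // (leq_trans (msizeZ_le _ _)).
move=> u p pz root_p i iN; rewrite rmorphB /= mmapZ substG.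
set r := subst_poly (line_param x u) Q.
have {}branchQ j : (j <= N)%N -> p`_j = r`_j by exact: branchQ pz root_p j.
have -> : subst_poly (line_param x u) (mmap (@mpolyC n F) (fcons Q (fun j => 'X_j)) A) =
          subst_poly (fcons r (line_param x u)) A.
  rewrite subst_poly_comp; apply: eq_subst_poly => j.
  rewrite (fcons_comp (fun B : {mpoly F[n]} => subst_poly (line_param x u) B)).
  by apply: eq_fcons => l /=; rewrite mmapX mmap1U.
rewrite coefB mul_polyC !coefZ coefXn.
have [iN'|Ni] := ltnP i N.+1; first by rewrite (ltn_eqF iN') !mulr0 subr0 branchQ.
have -> : i = N.+1 by apply/eqP; rewrite eqn_leq iN.
have rz : r.[0] = z by rewrite -pz !horner_coef0 branchQ.
have := newton_coef branchQ root_p.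
rewrite horner_subst_graph scale0r addr0 rz -/c eqxx mulr1 addrC => /eqP.
rewrite addr_eq0 => /eqP/(canRL (mulfK c0))/eqP.
by rewrite subr_eq => /eqP ->; rewrite addrC mulNr mulrC.
Qed.

End Graph.

(** * Polynomials vanishing on a set *)

Section MinimalVanishing.
Variables (F : finFieldType) (k : nat).
Implicit Types (A B : {mpoly F[k]}) (m : 'X_{1..k}).

Lemma msupp_mderiv A i m : m \in msupp A^`M(i) -> (m + U_(i))%MM \in msupp A.
Proof.
rewrite !mcoeff_msupp mcoeff_mderiv.
by apply: contraNneq => ->; rewrite mul0rn.
Qed.

Lemma mmeasure_mderiv (mf : measure k) A i : (mmeasure mf A^`M(i) <= mmeasure mf A)%N.
Proof.
rewrite [leqLHS]mmeasureE; apply/bigmax_leqP_seq => m /msupp_mderiv mA _.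
by apply: leq_ltn_trans (mmeasure_mnm_lt mf mA); rewrite mfD leq_addr.
Qed.

Lemma msize_mderiv A i : A != 0 -> (msize A^`M(i) < msize A)%N.
Proof.
move=> /(mpolySpred (@mdeg k)) ->; rewrite ltnS msizeE.
apply/bigmax_leqP_seq => m /msupp_mderiv /msize_mdeg_lt mA _.
by rewrite -ltnS; apply: leq_trans (leqSpred _); rewrite mdegD mdeg1 addn1 in mA.
Qed.

Lemma mderiv_eq0_dvdn (p : nat) A m (i : 'I_k) :
  p \in [pchar F] -> A^`M(i) = 0 -> m \in msupp A -> (p %| m i)%N.
Proof.
move=> pcharF dA0 mA; case def_mi: (m i) => [|l]; first exact: dvdn0.
have := mcoeff_mderiv i A (m - U_(i))%MM; rewrite dA0 mcoeff0.
rewrite submK; last by rewrite lep1mP def_mi.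
rewrite mnmBE mnm1E eqxx def_mi subn1 /= -mulr_natr => /esym/eqP.
rewrite mulf_eq0 -[_ == 0]negbK -mcoeff_msupp mA /=.
by rewrite (dvdn_pcharf pcharF).
Qed.

Lemma frobenius_surjective (p : nat) : p \in [pchar F] ->
  exists g : F -> F, forall c, g c ^+ p = c.
Proof.
move=> pcharF; have [|g _ gK] := @injF_bij _ (pFrobenius_aut pcharF).
  exact: fmorph_inj.
by exists g => c; rewrite -(pFrobenius_autE pcharF) gK.
Qed.

Lemma pth_power_of_mderiv_eq0 A : (forall i, A^`M(i) = 0) ->
  exists (p : nat) B, [/\ (1 < p)%N, A = B ^+ p &
    {in msupp B, forall m, (m *+ p)%MM \in msupp A}].
Proof.
move=> dA0; have [p p_pr pcharF] := finPcharP F.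
have [g gK] := frobenius_surjective pcharF.
pose root m : 'X_{1..k} := [multinom (m i %/ p)%N | i < k].
have rootK m : m \in msupp A -> (root m *+ p)%MM = m.
  move=> mA; apply/mnmP => i; rewrite mulmnE mnmE divnK //.
  exact: mderiv_eq0_dvdn pcharF (dA0 i) mA.
exists p, (\sum_(m <- msupp A) g A@_m *: 'X_[root m]); split.
- exact: prime_gt1.
- have pchar_mpoly : p \in [pchar {mpoly F[k]}] by rewrite pchar_lalg.
  rewrite -(pFrobenius_autE pchar_mpoly) rmorph_sum [LHS]mpolyE !big_seq /=.
  by apply: eq_bigr => m mA; rewrite pFrobenius_autE exprZn gK mpolyXn rootK.
- move=> m /msupp_sum_le; rewrite filter_predT => /flattenP[t /mapP[m' m'A ->]].
  by move=> /msuppZ_le /mem_msuppXP <-; rewrite rootK.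
Qed.

Lemma mmeasure_pth_root (mf : measure k) (p : nat) A B : (0 < p)%N ->
  {in msupp B, forall m, (m *+ p)%MM \in msupp A} -> (mmeasure mf B <= mmeasure mf A)%N.
Proof.
move=> p_gt0 suppB; rewrite [leqLHS]mmeasureE; apply/bigmax_leqP_seq => m /suppB mA _.
by apply: leq_ltn_trans (mmeasure_mnm_lt mf mA); rewrite mfMn leq_pmulr.
Qed.

Lemma msize_pth_root (p : nat) A B : (1 < p)%N -> (1 < msize B)%N ->
  {in msupp B, forall m, (m *+ p)%MM \in msupp A} -> (msize B < msize A)%N.
Proof.
move=> p_gt1 size_B suppB; have B0 : B != 0 by apply: contraTneq size_B => ->;
  rewrite msize0.
have := msize_mdeg_lt (suppB _ (mlead_supp B0)); rewrite mdegMn.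
move: size_B; rewrite -(mlead_deg B0); move: (mdeg _) (msize A) => a b; nia.
Qed.

Definition derivative_minimal (T : ('I_k -> F) -> Prop) B : Prop :=
  [/\ forall v, T v -> B.@[v] = 0,
    forall i, (forall v, T v -> (B^`M(i)).@[v] = 0) -> B^`M(i) = 0 &
    exists i, B^`M(i) != 0].

(* Take B of least degree: were all its partial derivatives zero, it would be a
   p-th power, and the root would still vanish on T. *)
Lemma derivative_minimal_exists (mf : measure k) (T : ('I_k -> F) -> Prop) A :
  (exists v, T v) -> A != 0 -> (forall v, T v -> A.@[v] = 0) ->
  exists2 B, (mmeasure mf B <= mmeasure mf A)%N & derivative_minimal T B.
Proof.
move=> [v0 Tv0]; have [N] := ubnP (msize A).
elim: N A => // N IH A; rewrite ltnS => size_A A0 TA.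
have descend B : (msize B < msize A)%N -> B != 0 -> (forall v, T v -> B.@[v] = 0) ->
    (mmeasure mf B <= mmeasure mf A)%N ->
    exists2 B', (mmeasure mf B' <= mmeasure mf A)%N & derivative_minimal T B'.
  move=> size_B B0 TB weight_B.
  have [B' weight_B' minB'] := IH B (leq_trans size_B size_A) B0 TB.
  by exists B' => //; exact: leq_trans weight_B' weight_B.
have [[i /eqP dAi0 dTi]|noA] :=
    pselect (exists2 i, A^`M(i) <> 0 & forall v, T v -> (A^`M(i)).@[v] = 0).
  exact: descend (msize_mderiv i A0) dAi0 dTi (mmeasure_mderiv mf A i).
have minA i : (forall v, T v -> (A^`M(i)).@[v] = 0) -> A^`M(i) = 0.
  by move=> dTi; apply: contrapT => dAi0; apply: noA; exists i.
have [?|dA0] := pselect (exists i, A^`M(i) != 0); first by exists A.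
have {}dA0 i : A^`M(i) = 0 by apply: contrapT => /eqP dAi0; apply: dA0; exists i.
have [p [B [p_gt1 defA suppB]]] := pth_power_of_mderiv_eq0 dA0.
have B0 : B != 0.
  by apply: contraNneq A0 => B0; rewrite defA B0 expr0n (gtn_eqF (ltnW p_gt1)).
have TB v : T v -> B.@[v] = 0.
  move=> /TA; rewrite defA rmorphXn => /eqP; rewrite expf_eq0.
  by case/andP=> _ /eqP.
have size_B : (1 < msize B)%N.
  rewrite ltnNge; apply: contra B0 => /msize1_polyC defB.
  by have := TB v0 Tv0; rewrite defB mevalC => ->; rewrite mpolyC0.
exact: descend (msize_pth_root p_gt1 size_B suppB) B0 TB
  (mmeasure_pth_root mf (ltnW p_gt1) suppB).
Qed.

End MinimalVanishing.

Lemma vanishing_mpoly_exists (F : fieldType) (k : nat) (T : finType)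
    (pt : T -> 'I_k -> F) (s : seq 'X_{1..k}) :
  uniq s -> (#|T| < size s)%N ->
  exists A : {mpoly F[k]}, [/\ A != 0, {subset msupp A <= s} &
    forall x, A.@[pt x] = 0].
Proof.
move=> uniq_s size_s; set N := size s in size_s *.
pose mon (i : 'I_N) : 'X_{1..k} := nth 0%MM s i.
pose M : 'M[F]_(N, #|T|) := \matrix_(i, j) \prod_l pt (enum_val j) l ^+ mon i l.
pose c := nz_row (kermx M).
have c0 : c != 0.
  rewrite nz_row_eq0 -mxrank_eq0 mxrank_ker subn_eq0 -ltnNge.
  exact: leq_ltn_trans (rank_leq_col M) size_s.
have cM : c *m M = 0 by apply/sub_kermxP/nz_row_sub.
have mon_inj : injective mon.
  by move=> i j /eqP; rewrite /mon nth_uniq // => /eqP; exact: val_inj.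
pose A := \sum_i c 0 i *: 'X_[mon i] : {mpoly F[k]}.
have coefA i : A@_(mon i) = c 0 i.
  rewrite /A raddf_sum (bigD1 i) //= big1 => [|j ji].
    by rewrite mcoeffZ mcoeffX eqxx mulr1 addr0.
  by rewrite mcoeffZ mcoeffX (inj_eq mon_inj) (negbTE ji) mulr0.
exists A; split.
- apply: contraNneq c0 => A0; apply/eqP/rowP => i.
  by rewrite -coefA A0 mcoeff0 mxE.
- move=> m /msupp_sum_le; rewrite filter_predT => /flattenP[t /mapP[i _ ->]].
  by move=> /msuppZ_le /mem_msuppXP <-; rewrite mem_nth.
- move=> x; rewrite /A raddf_sum /=.
  transitivity ((c *m M) 0 (enum_rank x)); last by rewrite cM mxE.
  rewrite mxE; apply: eq_bigr => i _.
  by rewrite mevalZ mevalX mxE enum_rankK.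
Qed.

(** * Averages and sampling *)

Reserved Notation "\avg_ ( i : t ) E"
  (at level 41, E at level 41, i at level 50, format "\avg_ ( i  :  t )  E").
Reserved Notation "\pr_ ( i : t ) E"
  (at level 41, E at level 41, i at level 50, format "\pr_ ( i  :  t )  E").

HB.lock Definition avg (R : numFieldType) (T : finType) (f : T -> R) : R :=
  (\sum_x f x) / #|T|%:R.

Notation "\avg_ ( i : t ) E" := (avg (fun i : t => E)) : ring_scope.
Notation "\pr_ ( i : t ) E" := (avg (fun i : t => (nat_of_bool E)%:R)) : ring_scope.

Section Averages.
Variable R : realFieldType.
Implicit Types (T S U : finType).

Lemma eq_avg T (f g : T -> R) : f =1 g -> avg f = avg g.
Proof. by move=> eq_fg; rewrite avg.unlock (eq_bigr g). Qed.

Lemma ler_avg T (f g : T -> R) : (forall x, f x <= g x) -> avg f <= avg g.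
Proof. by move=> le_fg; rewrite avg.unlock ler_wpM2r ?invr_ge0 ?ler0n // ler_sum. Qed.

Lemma avg_const T (x0 : T) (c : R) : \avg_(_ : T) c = c.
Proof.
rewrite avg.unlock sumr_const -[c *+ _]mulr_natr mulfK // pnatr_eq0 -lt0n.
by apply/card_gt0P; exists x0.
Qed.

Lemma avg_ge0 T (f : T -> R) : (forall x, 0 <= f x) -> 0 <= avg f.
Proof. by move=> f_ge0; rewrite avg.unlock divr_ge0 ?ler0n // sumr_ge0. Qed.

Lemma avg_le T (x0 : T) (f : T -> R) c : (forall x, f x <= c) -> avg f <= c.
Proof. by move=> f_le; rewrite -[leRHS](avg_const x0) ler_avg. Qed.

Lemma avg_ge T (x0 : T) (f : T -> R) c : (forall x, c <= f x) -> c <= avg f.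
Proof. by move=> f_ge; rewrite -[leLHS](avg_const x0) ler_avg. Qed.

Lemma avgD T (f g : T -> R) : \avg_(x : T) (f x + g x) = avg f + avg g.
Proof. by rewrite avg.unlock big_split mulrDl. Qed.

Lemma avgN T (f : T -> R) : \avg_(x : T) (- f x) = - avg f.
Proof. by rewrite avg.unlock sumrN mulNr. Qed.

Lemma avgB T (f g : T -> R) : \avg_(x : T) (f x - g x) = avg f - avg g.
Proof. by rewrite avgD avgN. Qed.

Lemma avgZ T (f : T -> R) c : \avg_(x : T) (c * f x) = c * avg f.
Proof. by rewrite avg.unlock -mulr_sumr mulrA. Qed.

Lemma avg_sum T (I : Type) (r : seq I) (P : pred I) (f : I -> T -> R) :
  \avg_(x : T) \sum_(i <- r | P i) f i x = \sum_(i <- r | P i) avg (f i).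
Proof. by rewrite avg.unlock exchange_big /= mulr_suml. Qed.

Lemma ler_norm_avg T (f : T -> R) : `|avg f| <= \avg_(x : T) `|f x|.
Proof.
rewrite avg.unlock normrM [X in _ * X]ger0_norm ?invr_ge0 ?ler0n //.
by rewrite ler_wpM2r ?invr_ge0 ?ler0n // ler_norm_sum.
Qed.

Lemma avgC T S (f : T -> S -> R) :
  \avg_(x : T) \avg_(y : S) f x y = \avg_(y : S) \avg_(x : T) f x y.
Proof.
rewrite avg.unlock -!mulr_suml exchange_big /=.
by rewrite -!mulrA [_^-1 * _]mulrC.
Qed.

Lemma avgCA T S U (f : T -> S -> U -> R) :
  \avg_(x : T) \avg_(y : S) \avg_(z : U) f x y z =
  \avg_(z : U) \avg_(x : T) \avg_(y : S) f x y z.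
Proof. by under eq_avg do rewrite avgC; rewrite avgC. Qed.

Lemma avgACA (T1 T2 S1 S2 : finType) (f : T1 -> T2 -> S1 -> S2 -> R) :
  \avg_(x : T1) \avg_(y : T2) \avg_(z : S1) \avg_(w : S2) f x y z w =
  \avg_(z : S1) \avg_(w : S2) \avg_(x : T1) \avg_(y : T2) f x y z w.
Proof.
under eq_avg do rewrite avgCA.
by rewrite avgC [RHS]avgC; apply: eq_avg => w; rewrite avgCA.
Qed.

Lemma avg_pair T S (f : T -> S -> R) :
  \avg_(x : T) \avg_(y : S) f x y = \avg_(p : T * S) f p.1 p.2.
Proof.
rewrite avg.unlock -mulr_suml pair_bigA /= card_prod natrM invfM.
by rewrite -mulrA [_^-1 * _]mulrC.
Qed.

Lemma avgM T S (f : T -> R) (g : S -> R) :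
  avg f * avg g = \avg_(x : T) \avg_(y : S) (f x * g y).
Proof.
transitivity (\avg_(x : T) (avg g * f x)); first by rewrite avgZ mulrC.
by apply: eq_avg => x; rewrite avgZ mulrC.
Qed.

Lemma avg_bij T S (h : S -> T) (f : T -> R) :
  bijective h -> avg f = \avg_(x : S) f (h x).
Proof.
move=> bij_h; rewrite avg.unlock (reindex h) /=; last by apply: onW_bij.
by rewrite (bij_eq_card bij_h).
Qed.

Lemma avg2_bij (T1 T2 S1 S2 : finType) (h : S1 * S2 -> T1 * T2) (f : T1 -> T2 -> R) :
  bijective h -> \avg_(x : T1) \avg_(y : T2) f x y =
    \avg_(x : S1) \avg_(y : S2) f (h (x, y)).1 (h (x, y)).2.
Proof.
by move=> bij_h; rewrite !avg_pair (avg_bij _ bij_h); apply: eq_avg => -[].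
Qed.

Lemma avg_ex_ge T (x0 : T) (f : T -> R) : exists x, avg f <= f x.
Proof.
pose x := [arg max_(x > x0) f x]%O; exists x.
by apply: (avg_le x0) => y; rewrite /x; case: arg_maxP => // z _; apply.
Qed.

Lemma avg_ex_le T (x0 : T) (f : T -> R) : exists x, f x <= avg f.
Proof.
have [x] := avg_ex_ge x0 (fun x => - f x); rewrite avgN lerN2 => le_f.
by exists x.
Qed.

Lemma avg_sqr_deviation T (x0 : T) (f : T -> R) :
  \avg_(x : T) (f x - avg f) ^+ 2 = \avg_(x : T) f x ^+ 2 - avg f ^+ 2.
Proof.
transitivity (\avg_(x : T) (f x ^+ 2 + (- (2 * avg f)) * f x + avg f ^+ 2)).
  by apply: eq_avg => x; ring.
by rewrite !avgD avgZ (avg_const x0); ring.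
Qed.

Lemma avg_sqr_le T (x0 : T) (f : T -> R) : avg f ^+ 2 <= \avg_(x : T) f x ^+ 2.
Proof.
by rewrite -subr_ge0 -(avg_sqr_deviation x0); apply: avg_ge0 => x; exact: sqr_ge0.
Qed.

Lemma pr_lt_half_avg T (x0 : T) (f : T -> R) : 0 < avg f ->
  \pr_(x : T) (f x < avg f / 2) <=
    4 / avg f ^+ 2 * (\avg_(x : T) f x ^+ 2 - avg f ^+ 2).
Proof.
set s := avg f => s_gt0; have s2_gt0 : 0 < s ^+ 2 by rewrite exprn_gt0.
rewrite -avg_sqr_deviation // -avgZ; apply: ler_avg => x.
case: ltP => [lt_f|_] /=; last by rewrite mulr_ge0 ?sqr_ge0 // divr_ge0 // ltW.
rewrite mulrAC ler_pdivlMr // mul1r -subr_ge0.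
have -> : 4 * (f x - s) ^+ 2 - s ^+ 2 = (s - 2 * f x) * (3 * s - 2 * f x) by ring.
by apply: mulr_ge0; lra.
Qed.

Lemma avg_in01 T (f : T -> R) : (forall x, 0 <= f x <= 1) -> 0 <= avg f <= 1.
Proof.
move=> f01; rewrite avg_ge0 => [|x]; last by case/andP: (f01 x).
have [/card0_eq T0|/card_gt0P[x0 _]] := posnP #|T|.
  by rewrite avg.unlock big1 ?mul0r ?ler01 // => x; have := T0 x.
by apply: (avg_le x0) => x; case/andP: (f01 x).
Qed.

Lemma indicator_in01 (b : bool) : 0 <= (b%:R : R) <= 1.
Proof. by rewrite ler0n lern1 leq_b1. Qed.

Lemma pr_in01 T (P : pred T) : 0 <= (\pr_(x : T) P x : R) <= 1.
Proof. by apply: avg_in01 => x; exact: indicator_in01. Qed.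

Lemma pr_ge0 T (P : pred T) : 0 <= \pr_(x : T) P x :> R.
Proof. by case/andP: (pr_in01 P). Qed.

Lemma pr_le1 T (P : pred T) : \pr_(x : T) P x <= 1 :> R.
Proof. by case/andP: (pr_in01 P). Qed.

Lemma pr_card T (P : pred T) : \pr_(x : T) P x = #|P|%:R / #|T|%:R :> R.
Proof. by rewrite avg.unlock -natr_sum -sum1_card [in RHS]big_mkcond. Qed.

Lemma pr_pred1 T (c : T) : \pr_(x : T) (x == c) = #|T|%:R^-1 :> R.
Proof. by rewrite pr_card card1 mul1r. Qed.

Lemma le_pr T (P Q : pred T) : (forall x, P x -> Q x) ->
  \pr_(x : T) P x <= \pr_(x : T) Q x :> R.
Proof.
move=> sPQ; apply: ler_avg => x; rewrite ler_nat.
by have := sPQ x; case: (P x) => // ->.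
Qed.

Lemma le_pr_or T (P Q S : pred T) : (forall x, P x -> Q x || S x) ->
  \pr_(x : T) P x <= \pr_(x : T) Q x + \pr_(x : T) S x :> R.
Proof.
move=> sPQS; rewrite -avgD; apply: ler_avg => x; rewrite -natrD ler_nat.
by have := sPQS x; case: (P x) (Q x) (S x) => [] [] [] // /(_ isT).
Qed.

Lemma pr_and_ge T (P Q : pred T) :
  \pr_(x : T) P x - \pr_(x : T) (~~ Q x) <= \pr_(x : T) (P x && Q x) :> R.
Proof.
rewrite lerBlDr; apply: le_pr_or => x.
by case: (P x); case: (Q x).
Qed.

Lemma pr_not T (x0 : T) (P : pred T) : \pr_(x : T) (~~ P x) = 1 - \pr_(x : T) P x :> R.
Proof.
rewrite -[X in X - _](avg_const x0) -avgB; apply: eq_avg => x.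
by case: (P x); rewrite ?subrr ?subr0.
Qed.

Lemma pr_exists_in T (I : finType) (L : {set I}) (P : I -> pred T) :
  \pr_(x : T) [exists i in L, P i x] <= \sum_(i in L) \pr_(x : T) P i x :> R.
Proof.
rewrite -avg_sum; apply: ler_avg => x.
case: existsP => [[i /andP[iL Pix]]|_]; last exact: sumr_ge0.
by rewrite (bigD1 i) //= Pix lerDl; apply: sumr_ge0.
Qed.

Lemma pr_neq_plurality T (S : eqType) (x0 : T) (k : T -> S) :
  exists z, \pr_(x : T) (k x != z) <= \avg_(y : T) \pr_(x : T) (k x != k y) :> R.
Proof.
by have [y le_y] := avg_ex_le x0 (fun y => \pr_(x : T) (k x != k y)); exists (k y).
Qed.

(* Second moment method: the number X of sets containing a random point satisfies
   (E X)^2 <= E X^2 <= E X + #|L|^2 gam, whereas E X >= #|L| del. *)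
Lemma card_almost_disjoint_le T (x0 : T) (I : finType) (L : {set I}) (A : I -> pred T)
    (del gam : R) :
  0 < del -> 0 <= gam -> 2 * gam < del ^+ 2 ->
  (forall i, i \in L -> del <= \pr_(x : T) A i x) ->
  (forall i j, i \in L -> j \in L -> i != j -> \pr_(x : T) (A i x && A j x) <= gam) ->
  #|L|%:R <= 2 / del.
Proof.
move=> del_gt0 gam_ge0 gam_small dense disjoint.
set N : R := #|L|%:R; rewrite ler_pdivlMr // leNgt; apply/negP => N_large.
pose EX := \sum_(i in L) \pr_(x : T) A i x : R.
have N_ge0 : 0 <= N by rewrite ler0n.
have EX_ge : N * del <= EX by rewrite mulr_natl -sumr_const ler_sum.
have EX2_le : EX ^+ 2 <= EX + N * (N * gam).
  rewrite /EX -avg_sum (le_trans (avg_sqr_le x0 _)) //.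
  have -> : \avg_(x : T) (\sum_(i in L) (A i x)%:R) ^+ 2 =
      \sum_(i in L) \sum_(j in L) \pr_(x : T) (A i x && A j x) :> R.
    under [RHS]eq_bigr do rewrite -avg_sum.
    rewrite -avg_sum; apply: eq_avg => x; rewrite expr2 big_distrlr /=.
    by do 2![apply: eq_bigr => ? _]; rewrite -natrM mulnb.
  rewrite avg_sum mulr_natl -sumr_const -big_split /=; apply: ler_sum => i iL.
  rewrite (bigD1 i) //=; apply: lerD; first by apply: le_pr => x; rewrite andbb.
  rewrite mulr_natl -sumr_const big_mkcondr; apply: ler_sum => j jL.
  by case: eqP => //= /eqP ij; apply: disjoint; rewrite // eq_sym.
have gam_lt : 2 * (N * (N * gam)) <= EX ^+ 2.
  have -> : 2 * (N * (N * gam)) = N ^+ 2 * (2 * gam) by ring.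
  apply: (@le_trans _ _ ((N * del) ^+ 2)).
    by rewrite exprMn ler_wpM2l ?sqr_ge0 // ltW.
  by rewrite lerXn2r // nnegrE ?mulr_ge0 // ?(le_trans _ EX_ge) // ?mulr_ge0 // ltW.
have EX_gt2 : 2 < EX := lt_le_trans N_large EX_ge.
by move: EX_gt2 gam_lt EX2_le; clear; nra.
Qed.

End Averages.

Section PlaneCoordinates.
Variable F : finFieldType.

Definition row2 (a b : F) : 'rV[F]_2 := \row_i (if i == 0 then a else b).

Lemma row2_0 a b : row2 a b 0 0 = a. Proof. by rewrite mxE. Qed.
Lemma row2_1 a b : row2 a b 0 1 = b. Proof. by rewrite mxE. Qed.

Lemma eq_row2 (y z : 'rV[F]_2) : y 0 0 = z 0 0 -> y 0 1 = z 0 1 -> y = z.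
Proof.
move=> eq0 eq1; apply/rowP => i; case: (unliftP 0 i) => [j ->|-> //].
by rewrite (ord1 j) (_ : lift 0 0 = 1) //; apply: val_inj.
Qed.

Lemma row2K (y : 'rV[F]_2) : row2 (y 0 0) (y 0 1) = y.
Proof. by apply: eq_row2; rewrite ?row2_0 ?row2_1. Qed.

Lemma row2_bij : bijective (fun p : F * F => row2 p.1 p.2).
Proof.
exists (fun y : 'rV[F]_2 => (y 0 0, y 0 1)) => [[a b]|y] /=; last exact: row2K.
by rewrite row2_0 row2_1.
Qed.

Definition det2 (w w' : 'rV[F]_2) : F := w 0 0 * w' 0 1 - w 0 1 * w' 0 0.

Variable m : nat.
Implicit Types (x u v : 'rV[F]_m) (y w : 'rV[F]_2).

Definition lincomb2 u v y : 'rV[F]_m := y 0 0 *: u + y 0 1 *: v.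

Definition plane_point x u v y : 'rV[F]_m := x + lincomb2 u v y.

Lemma lincomb2_row2 u v a b : lincomb2 u v (row2 a b) = a *: u + b *: v.
Proof. by rewrite /lincomb2 row2_0 row2_1. Qed.

Lemma plane_point0 x u v : plane_point x u v 0 = x.
Proof. by rewrite /plane_point /lincomb2 !mxE !scale0r !addr0. Qed.

Lemma plane_point_line x u v y w t :
  plane_point x u v (y + t *: w) = plane_point x u v y + t *: lincomb2 u v w.
Proof. by rewrite /plane_point /lincomb2; apply/rowP => i; rewrite !mxE; ring. Qed.

Lemma plane_point_axis x u v s : plane_point x u v (row2 s 0) = x + s *: u.
Proof. by rewrite /plane_point lincomb2_row2 scale0r addr0. Qed.

Lemma lincomb2_pair_bij w w' : det2 w w' != 0 ->
  bijective (fun p : 'rV[F]_m * 'rV[F]_m => (lincomb2 p.1 p.2 w, lincomb2 p.1 p.2 w')).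
Proof.
rewrite /det2; set D := (X in X != 0) => D0.
exists (fun p : 'rV[F]_m * 'rV[F]_m =>
  (D^-1 *: (w' 0 1 *: p.1 - w 0 1 *: p.2),
   D^-1 *: (w 0 0 *: p.2 - w' 0 0 *: p.1))) => [[u v]|[u v]] /=.
all: by congr pair; apply/rowP => i; rewrite !mxE /D; field.
Qed.

End PlaneCoordinates.

Section UniformSampling.
Variables (R : realFieldType) (F : finFieldType).
Local Notation q := (#|F|%:R : R).

Lemma card_field_gt0 : 0 < q.
Proof. by rewrite ltr0n; apply/card_gt0P; exists 0. Qed.

Lemma invq_gt0 : 0 < q^-1.
Proof. by rewrite invr_gt0 card_field_gt0. Qed.

Lemma ratio_card_field_le (c x : R) : 0 < c -> c * x <= q -> x / q <= c^-1.
Proof.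
by move=> c_gt0; rewrite ler_pdivrMr ?card_field_gt0 // ler_pdivlMl.
Qed.

Lemma inv_card_rV_le n : (#|{: 'rV[F]_n.+1}|%:R : R)^-1 <= q^-1.
Proof.
rewrite card_mx mul1n natrX exprS invfM ger_pMr ?invq_gt0 //.
by rewrite invf_le1 ?exprn_gt0 ?card_field_gt0 // exprn_ege1 // ler1n; apply/card_gt0P;
  exists 0.
Qed.

Lemma avg_addr (V : finZmodType) (G : V -> R) a : \avg_(x : V) G (x + a) = avg G.
Proof.
rewrite [RHS](avg_bij (h := fun x => x + a)) //.
by exists (fun x => x - a) => x; rewrite ?addrK ?subrK.
Qed.

Lemma avg_addl (V : finZmodType) (G : V -> R) a : \avg_(x : V) G (a + x) = avg G.
Proof. by rewrite -[RHS](avg_addr G a); apply: eq_avg => x; rewrite addrC. Qed.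

Lemma avg_row2 (G : 'rV[F]_2 -> R) :
  avg G = \avg_(a : F) \avg_(b : F) G (row2 a b).
Proof. by rewrite (avg_bij _ (row2_bij F)) avg_pair. Qed.

Lemma pr_hyperplane n (a : 'I_n -> F) i : a i != 0 ->
  \pr_(u : 'rV[F]_n) (\sum_j a j * u 0 j == 0) = q^-1.
Proof.
move=> ai0; pose e : 'rV[F]_n := delta_mx 0 i.
transitivity (\avg_(t : F) \pr_(u : 'rV[F]_n) (\sum_j a j * (u + t *: e) 0 j == 0) : R).
  rewrite -[LHS](avg_const (0 : F)); apply: eq_avg => t.
  by rewrite (avg_addr (fun u : 'rV[F]_n => (\sum_j a j * u 0 j == 0)%:R)).
rewrite avgC -[RHS](avg_const (0 : 'rV[F]_n)); apply: eq_avg => u.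
rewrite -(pr_pred1 R (- (\sum_j a j * u 0 j) / a i)); apply: eq_avg => t.
have -> : \sum_j a j * (u + t *: e) 0 j = \sum_j a j * u 0 j + t * a i.
  rewrite (bigD1 i) //= [in RHS](bigD1 i) //= !mxE !eqxx mulr1 mulrDr -!addrA.
  congr (_ + _); rewrite [LHS]addrC [a i * t]mulrC; congr (_ + _).
  by apply: eq_bigr => j /negbTE ji; rewrite !mxE ji andbF mulr0 addr0.
congr (nat_of_bool _)%:R; rewrite addrC addr_eq0.
by apply/eqP/eqP => [<-|->]; rewrite ?mulfK ?divfK.
Qed.

Lemma pr_det2_eq0 :
  \avg_(w : 'rV[F]_2) \pr_(w' : 'rV[F]_2) (det2 w w' == 0) <= 2 / q.
Proof.
apply: (@le_trans _ _ (\avg_(w : 'rV[F]_2) ((w == 0)%:R + q^-1))); last first.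
  by rewrite avgD pr_pred1 (avg_const 0); have := inv_card_rV_le 1; lra.
apply: ler_avg => w; have [_|w0] := eqVneq w 0.
  by rewrite (le_trans (pr_le1 _ _)) // lerDl ltW ?invq_gt0.
pose a (i : 'I_2) := if i == 0 then - w 0 1 else w 0 0.
have det2E w' : det2 w w' = \sum_i a i * w' 0 i.
  rewrite !big_ord_recl big_ord0 addr0 /a /= /det2 addrC mulNr.
  by congr (_ + _ * w' 0 _); apply: val_inj.
rewrite add0r; under eq_avg do rewrite det2E.
have [w00|w00] := eqVneq (w 0 0) 0; last by rewrite (@pr_hyperplane _ _ 1) //= /a.
rewrite (@pr_hyperplane _ _ 0) //= /a /= oppr_eq0.
by apply: contraNneq w0 => w01; apply/eqP/eq_row2; rewrite !mxE.
Qed.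

Variable m : nat.
Local Notation V := 'rV[F]_m.
Local Notation W := 'rV[F]_2.
Implicit Types (G : V -> V -> R) (g : V -> R).

Lemma avg_scale g (c : F) : c != 0 -> \avg_(x : V) g (c *: x) = avg g.
Proof.
move=> c0; rewrite [RHS](avg_bij (h := fun x => c *: x)) //.
by exists (fun x => c^-1 *: x) => x; rewrite scalerA ?mulVf ?mulfV // scale1r.
Qed.

Lemma avg_line_shift G :
  \avg_(x : V) \avg_(u : V) \avg_(t : F) G (x + t *: u) u =
  \avg_(x : V) \avg_(u : V) G x u.
Proof.
rewrite [LHS]avgC [RHS]avgC; apply: eq_avg => u; rewrite avgC.
rewrite -[RHS](avg_const (0 : F)); apply: eq_avg => t.
exact: (avg_addr (fun x => G x u)).
Qed.

Lemma avg_lincomb2_pair G (w w' : W) : det2 w w' != 0 ->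
  \avg_(u : V) \avg_(v : V) G (lincomb2 u v w) (lincomb2 u v w') =
  \avg_(u : V) \avg_(v : V) G u v.
Proof.
move=> /(lincomb2_pair_bij m)/(avg2_bij G) ->.
by [].
Qed.

Lemma avg_line_points G (t t' : F) : t != t' ->
  \avg_(x : V) \avg_(u : V) G (x + t *: u) (x + t' *: u) =
  \avg_(x : V) \avg_(y : V) G x y.
Proof.
move=> tt'; rewrite -(@avg_lincomb2_pair G (row2 1 t) (row2 1 t')).
  by apply: eq_avg => x; apply: eq_avg => u; rewrite !lincomb2_row2 !scale1r.
by rewrite /det2 !row2_0 !row2_1 mul1r mulr1 subr_eq0 eq_sym.
Qed.

Lemma avg_lincomb2_transverse g (w : W) u : w 0 1 != 0 ->
  \avg_(v : V) g (lincomb2 u v w) = avg g.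
Proof.
by move=> w1; rewrite /lincomb2 (avg_scale (fun v => g (w 0 0 *: u + v)) w1) avg_addl.
Qed.

Lemma avg_cone_dist g x : (forall y, 0 <= g y <= 1) ->
  `|\avg_(u : V) \avg_(t : F) g (x + t *: u) - avg g| <= q^-1.
Proof.
move=> g01; rewrite avgC -[X in _ - X](avg_const (0 : F)) -avgB.
rewrite (le_trans (ler_norm_avg _)) // -(pr_pred1 R (0 : F)).
apply: ler_avg => t; have [->|t0] := eqVneq t 0; last first.
  by rewrite (avg_scale (fun u => g (x + u)) t0) (avg_addl g) subrr normr0.
under eq_avg do rewrite scale0r addr0; rewrite (avg_const 0).
have /andP[gx_ge0 gx_le1] := g01 x; have /andP[g_ge0 g_le1] := avg_in01 g01.
by rewrite ler_norml /=; apply/andP; split; lra.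
Qed.

Lemma avg_cone_le g x : (forall y, 0 <= g y <= 1) ->
  \avg_(u : V) \avg_(t : F) g (x + t *: u) <= avg g + q^-1.
Proof. by move=> /(avg_cone_dist x)/ler_distlDr. Qed.

Lemma avg_planes_dist G : (forall u v, 0 <= G u v <= 1) ->
  `|\avg_(u : V) \avg_(v : V)
      \avg_(w : W) \avg_(w' : W) G (lincomb2 u v w) (lincomb2 u v w')
    - \avg_(u : V) \avg_(v : V) G u v| <= 2 / q.
Proof.
move=> G01; rewrite avgACA; set g := (X in _ - X).
rewrite -[g](avg_const (0 : W)) -avgB (le_trans (ler_norm_avg _)) //.
apply: le_trans pr_det2_eq0; apply: ler_avg => w.
rewrite -[g](avg_const (0 : W)) -avgB (le_trans (ler_norm_avg _)) //.
apply: ler_avg => w'; have [_|D0] := eqVneq (det2 w w') 0; last first.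
  by rewrite avg_lincomb2_pair // subrr normr0.
have /andP[g_ge0 g_le1] : 0 <= g <= 1 by do 2![apply: avg_in01 => ?]; exact: G01.
have /andP[gw_ge0 gw_le1] :
    0 <= \avg_(u : V) \avg_(v : V) G (lincomb2 u v w) (lincomb2 u v w') <= 1.
  by do 2![apply: avg_in01 => ?]; exact: G01.
by rewrite ler_norml /=; apply/andP; split; lra.
Qed.

Lemma avg_le_planes G : (forall u v, 0 <= G u v <= 1) ->
  \avg_(u : V) \avg_(v : V) G u v <= \avg_(u : V) \avg_(v : V)
    \avg_(w : W) \avg_(w' : W) G (lincomb2 u v w) (lincomb2 u v w') + 2 / q.
Proof. by move=> /avg_planes_dist; rewrite distrC => /ler_distlDr. Qed.

End UniformSampling.

(** * Polynomial functions *)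

Section LineSampling.
Variables (R : realFieldType) (F : finFieldType) (m : nat).
Local Notation q := (#|F|%:R : R).
Local Notation V := 'rV[F]_m.
Variable S : pred V.
Local Notation s := (\pr_(x : V) S x : R).

Definition line_density (x u : V) : R := \pr_(t : F) S (x + t *: u).

Lemma line_density_mean : \avg_(x : V) \avg_(u : V) line_density x u = s.
Proof.
rewrite (avg_line_shift (fun x _ => (S x)%:R)).
by apply: eq_avg => x; rewrite (avg_const 0).
Qed.

Lemma line_density_second_moment :
  \avg_(x : V) \avg_(u : V) line_density x u ^+ 2 <= s ^+ 2 + s / q.
Proof.
have -> : \avg_(x : V) \avg_(u : V) line_density x u ^+ 2 =
    \avg_(t : F) \avg_(t' : F) \avg_(x : V) \avg_(u : V)
      ((S (x + t *: u))%:R * (S (x + t' *: u))%:R).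
  rewrite avgACA; apply: eq_avg => x; apply: eq_avg => u.
  by rewrite expr2 /line_density avgM.
apply: (@le_trans _ _ (\avg_(t : F) \avg_(t' : F) (s ^+ 2 + s * (t' == t)%:R))).
  apply: ler_avg => t; apply: ler_avg => t'; have [->|tt'] := eqVneq t' t.
    apply: (@le_trans _ _ s); last by rewrite mulr1 lerDr sqr_ge0.
    rewrite avgC; apply: (avg_le 0) => u.
    rewrite -(avg_addr (fun x => (S x)%:R) (t *: u)); apply: ler_avg => x.
    by case: (S _); rewrite /= ?mulr1 ?mulr0.
  rewrite (avg_line_points (fun x y => (S x)%:R * (S y)%:R)) 1?eq_sym //.
  by rewrite mulr0 addr0 -avgM expr2.
apply: (avg_le 0) => t.
by rewrite avgD (avg_const 0) avgZ pr_pred1.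
Qed.

Lemma line_sampling : 0 < s ->
  \avg_(x : V) \pr_(u : V) (line_density x u < s / 2) <= 4 / (s * q).
Proof.
move=> s_gt0; have q_gt0 := card_field_gt0 R F.
have mean : \avg_(p : V * V) line_density p.1 p.2 = s.
  by rewrite -avg_pair line_density_mean.
rewrite avg_pair -mean; apply: le_trans (pr_lt_half_avg (0, 0) _) _; rewrite mean //.
rewrite -(avg_pair (fun x u => line_density x u ^+ 2)).
have -> : 4 / (s * q) = 4 / s ^+ 2 * (s / q) by field; rewrite !gt_eqF.
rewrite ler_wpM2l ?divr_ge0 ?exprn_ge0 ?(ltW s_gt0) //.
by have := line_density_second_moment; lra.
Qed.

End LineSampling.

Definition polyfun (F : finFieldType) (m d : nat) (h : 'rV[F]_m -> F) : Prop :=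
  exists2 Q : {mpoly F[m]}, tdeg_le d Q & forall x, h x = mpeval Q x.

Section PolyAgreement.
Variable F : finFieldType.

Lemma poly_eq_on (p r : {poly F}) (k : nat) (S : pred F) :
  (size p <= k)%N -> (size r <= k)%N -> (k <= #|S|)%N ->
  (forall t, S t -> p.[t] = r.[t]) -> p = r.
Proof.
move=> size_p size_r card_S eq_pr; apply/eqP; rewrite -subr_eq0; apply/negP => /negP pr0.
have : all (root (p - r)) (enum S).
  by apply/allP => t; rewrite mem_enum => /eq_pr e; rewrite rootE !hornerE e subrr.
move/(max_poly_roots pr0)/(_ (enum_uniq _)); rewrite -cardE ltnNge.
case/negP; apply: leq_trans card_S; apply: (leq_trans (size_polyD _ _)).
by rewrite geq_max size_p size_polyN.
Qed.

Variable R : realFieldType.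
Local Notation q := (#|F|%:R : R).

Lemma poly_eq_pr (p r : {poly F}) (d : nat) (S : pred F) :
  (size p <= d.+1)%N -> (size r <= d.+1)%N ->
  d%:R / q < \pr_(t : F) S t ->
  (forall t, S t -> p.[t] = r.[t]) -> p = r.
Proof.
move=> size_p size_r dense; apply: (poly_eq_on size_p size_r); move: dense.
by rewrite pr_card ltr_pM2r ?invq_gt0 // ltr_nat.
Qed.

(* Most p_v agree with y at most points; one that does, and is right at t,
   agrees with a fixed such p_v0 at more than d points, hence at t. *)
Lemma majority_poly (T : finType) (v0 : T) (p : T -> {poly F}) (y : F -> F) (d : nat)
    (del : R) :
  (forall v, (size (p v) <= d.+1)%N) ->
  (forall t, \pr_(v : T) ((p v).[t] != y t) <= del) -> 4 * del + d%:R / q < 1 ->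
  exists2 r : {poly F}, (size r <= d.+1)%N & forall t, y t = r.[t].
Proof.
move=> size_p wrong small; have dq_ge0 : 0 <= d%:R / q by rewrite divr_ge0 ?ler0n.
pose N v : R := \pr_(t : F) ((p v).[t] != y t).
have N_ge0 v : 0 <= N v := pr_ge0 _ _.
have avg_N : avg N <= del by rewrite /N avgC; apply: (avg_le 0).
have [v1 N_v1] := avg_ex_le v0 N; exists (p v1) => // t.
have [v le_v] := avg_ex_le v0 (fun v => ((p v).[t] != y t)%:R + 3 * N v).
have {le_v} : ((p v).[t] != y t)%:R + 3 * N v <= 4 * del.
  by apply: (le_trans le_v); rewrite avgD avgZ; have := wrong t; lra.
have N_v := N_ge0 v; have [<- /= le_v|_ /= le_v] := eqVneq (p v).[t] (y t);
  last by exfalso; lra.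
congr (_.[t]).
apply: (poly_eq_pr (S := fun t => ((p v).[t] == y t) && ((p v1).[t] == y t))) => //.
  apply: lt_le_trans (pr_and_ge _ _ _); rewrite -/(N v1).
  have := pr_not R 0 (fun t => (p v).[t] != y t); rewrite -/(N v).
  by under eq_avg do rewrite negbK; lra.
by move=> t' /andP[/eqP -> /eqP ->].
Qed.

End PolyAgreement.

Section PolyFun.
Variable F : finFieldType.

Section Closure.
Variable m : nat.
Implicit Types (g h : 'rV[F]_m -> F) (a b d : nat).

Lemma polyfun_line d h x u : polyfun d h ->
  exists2 p : {poly F}, (size p <= d.+1)%N & forall t, h (x + t *: u) = p.[t].
Proof.
move=> [Q degQ hQ]; exists (subst_poly (line_param x u) Q).
  exact: leq_trans (size_subst_line x u Q) degQ.
by move=> t; rewrite horner_subst_line hQ.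
Qed.

Lemma eq_polyfun d g h : g =1 h -> polyfun d g -> polyfun d h.
Proof. by move=> eq_gh [Q degQ gQ]; exists Q => // x; rewrite -eq_gh. Qed.

Lemma polyfun_const d (c : F) : polyfun d (fun _ : 'rV[F]_m => c).
Proof.
exists c%:MP => [|x]; last by rewrite /mpeval mevalC.
by rewrite /tdeg_le mmeasureC (leq_trans (leq_b1 _)).
Qed.

Lemma polyfun_coord i : polyfun 1 (fun x : 'rV[F]_m => x 0 i).
Proof.
by exists 'X_i => [|x]; rewrite ?/mpeval ?mevalXU // /tdeg_le msizeX mdeg1.
Qed.

Lemma polyfunD d g h : polyfun d g -> polyfun d h -> polyfun d (fun x => g x + h x).
Proof.
move=> [Q degQ gQ] [Q' degQ' hQ']; exists (Q + Q') => [|x].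
  by apply: (leq_trans (mmeasureD_le _ _ _)); rewrite geq_max; apply/andP.
by rewrite gQ hQ' /mpeval mevalD.
Qed.

Lemma polyfunM a b g h :
  polyfun a g -> polyfun b h -> polyfun (a + b) (fun x => g x * h x).
Proof.
move=> [Q degQ gQ] [Q' degQ' hQ']; exists (Q * Q') => [|x]; first exact: msizeM_leq.
by rewrite gQ hQ' /mpeval mevalM.
Qed.

Lemma leq_polyfun a b g : (a <= b)%N -> polyfun a g -> polyfun b g.
Proof. by move=> ab [Q degQ gQ]; exists Q => //; apply: leq_trans degQ _. Qed.

Lemma polyfun_sum (I : Type) (r : seq I) (G : I -> 'rV[F]_m -> F) d :
  (forall i, polyfun d (G i)) -> polyfun d (fun x => \sum_(i <- r) G i x).
Proof.
move=> polyG; elim: r => [|i r IH].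
  by apply: eq_polyfun (polyfun_const d 0) => x; rewrite big_nil.
by apply: eq_polyfun (polyfunD (polyG i) IH) => x; rewrite big_cons.
Qed.

Lemma polyfun_prod (I : Type) (r : seq I) (G : I -> 'rV[F]_m -> F) (a : I -> nat) :
  (forall i, polyfun (a i) (G i)) ->
  polyfun (\sum_(i <- r) a i) (fun x => \prod_(i <- r) G i x).
Proof.
move=> polyG; elim: r => [|i r IH].
  by apply: eq_polyfun (polyfun_const _ 1) => x; rewrite big_nil.
rewrite big_cons; apply: eq_polyfun (polyfunM (polyG i) IH) => x.
by rewrite big_cons.
Qed.

Lemma polyfun_exp a g k : polyfun a g -> polyfun (a * k) (fun x => g x ^+ k).
Proof.
move=> poly_g; elim: k => [|k IH].
  by apply: eq_polyfun (polyfun_const _ 1) => x; rewrite expr0.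
by rewrite mulnS; apply: eq_polyfun (polyfunM poly_g IH) => x; rewrite exprS.
Qed.

Lemma polyfun_affine n d (h : 'rV[F]_n -> F) (g : 'I_n -> 'rV[F]_m -> F) :
  polyfun d h -> (forall j, polyfun 1 (g j)) -> polyfun d (fun x => h (\row_j g j x)).
Proof.
move=> [Q degQ hQ] poly_g.
pose term (k : 'X_{1..n}) x := if k \in msupp Q then Q@_k * \prod_j g j x ^+ k j else 0.
apply: eq_polyfun (_ : polyfun d (fun x => \sum_(k <- msupp Q) term k x)).
  move=> x; rewrite hQ /mpeval mevalE !big_seq; apply: eq_bigr => k kQ.
  by rewrite /term kQ; congr (_ * _); apply: eq_bigr => j _; rewrite mxE.
apply: polyfun_sum => k; rewrite /term; case kQ: (k \in msupp Q);
  last exact: polyfun_const.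
apply: (@leq_polyfun (0 + mdeg k)).
  by have := leq_trans (msize_mdeg_lt kQ) degQ; rewrite ltnS.
apply: polyfunM; first exact: polyfun_const.
rewrite mdegE; apply: polyfun_prod => j.
by have := polyfun_exp (k j) (poly_g j); rewrite mul1n.
Qed.

Lemma polyfun_translate d h z : polyfun d h -> polyfun d (fun x => h (z + x)).
Proof.
move=> poly_h; have poly_z j : polyfun 1 (fun x : 'rV[F]_m => z 0 j + x 0 j).
  by apply: polyfunD; [exact: polyfun_const | exact: polyfun_coord].
apply: eq_polyfun (polyfun_affine poly_h poly_z) => x.
by congr h; apply/rowP => j; rewrite !mxE.
Qed.

Lemma polyfun_horner a d g (p : {poly F}) : (size p <= d.+1)%N ->
  polyfun a g -> polyfun (a * d) (fun x => p.[g x]).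
Proof.
move=> size_p poly_g.
apply: eq_polyfun (_ : polyfun _ (fun x => \sum_(i < d.+1) p`_i * g x ^+ i)).
  by move=> x; rewrite (horner_coef_wide _ size_p).
apply: polyfun_sum => i; apply: (@leq_polyfun (0 + a * i)).
  by rewrite leq_mul2l -ltnS ltn_ord orbT.
by apply: polyfunM; [exact: polyfun_const | exact: polyfun_exp].
Qed.

Lemma polyfun_of_radial b d g : (b < #|F|)%N -> (d <= b)%N -> polyfun b g ->
  (forall u, exists2 p : {poly F}, (size p <= d.+1)%N & forall t, g (t *: u) = p.[t]) ->
  polyfun d g.
Proof.
move=> bq db [Q degQ gQ] radial; have [G taylorG] := taylor_parts 0 Q.
exists (\sum_(k < d.+1) G k).
  apply: (leq_trans (mmeasure_sum _ _ _ _)); apply/bigmax_leqP => k _.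
  by apply: leq_trans (taylorG k).1 _.
move=> u; have [p size_p gp] := radial u.
have eq_p : subst_poly (line_param 0 u) Q = p.
  apply: (@poly_eq_on F _ _ b.+1 predT).
  - exact: leq_trans (size_subst_line 0 u Q) degQ.
  - by apply: leq_trans size_p _; rewrite ltnS.
  - exact: bq.
  - by move=> t _; rewrite horner_subst_line -gp gQ add0r.
rewrite -[u]scale1r gp scale1r (horner_coef_wide _ size_p) /mpeval raddf_sum /=.
apply: eq_bigr => k _; rewrite expr1n mulr1 -eq_p.
have := congr1 (fun r : {poly F} => r.[1]) ((taylorG k).2 u).
rewrite /= horner_subst_line hornerZ hornerXn expr1n mulr1 => <-.
by apply: meval_eq => i; rewrite scale1r add0r.
Qed.

End Closure.

Lemma lagrange_basis_exists (d : nat) : (d < #|F|)%N ->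
  exists (a : 'I_d.+1 -> F) (L : 'I_d.+1 -> {poly F}),
    (forall i, (size (L i) <= d.+1)%N) /\
    forall p : {poly F}, (size p <= d.+1)%N -> p = \sum_i p.[a i] *: L i.
Proof.
move=> dq; pose a (i : 'I_d.+1) := enum_val (widen_ord dq i).
have a_inj : injective a.
  by move=> i j /enum_val_inj /(congr1 val) /= eq_ij; apply: val_inj.
pose M := Vandermonde d.+1 (\row_i a i).
have unitM : M \in unitmx.
  rewrite unitmxE det_Vandermonde unitfE; apply/prodf_neq0 => i _;
    apply/prodf_neq0 => j ij.
  by rewrite !mxE subr_eq0 (inj_eq a_inj) -val_eqE gtn_eqF.
exists a, (fun i => rVpoly (row i (invmx M))); split=> [i|p size_p];
  first exact: size_poly.
have values_p : poly_rV p *m M = \row_i p.[a i].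
  apply/rowP => j; rewrite !mxE (horner_coef_wide _ size_p).
  by apply: eq_bigr => i _; rewrite !mxE.
rewrite -[LHS](poly_rV_K size_p) -[poly_rV p](mulmxK unitM) values_p.
rewrite [X in rVpoly X]mulmx_sum_row raddf_sum /=.
by apply: eq_bigr => i _; rewrite linearZ mxE.
Qed.

(* Interpolating in one coordinate gives degree at most 2d; lines through the
   origin then bound the total degree by d. *)
Theorem polyfun_of_lines m d (g : 'rV[F]_m -> F) : (2 * d < #|F|)%N ->
  (forall x u, exists2 p : {poly F}, (size p <= d.+1)%N &
     forall t, g (x + t *: u) = p.[t]) -> polyfun d g.
Proof.
move=> dq; elim: m g => [|m IH] g g_line.
  by apply: eq_polyfun (polyfun_const 0 d (g 0)) => x; rewrite [x]thinmx0.
apply: (polyfun_of_radial dq) => [||u]; first by rewrite leq_pmull.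
  pose at0 (s : F) (y : 'rV[F]_m) : 'rV[F]_(1 + m) := row_mx s%:M y.
  have at0D s s' y y' t : at0 (s + t * s') (y + t *: y') = at0 s y + t *: at0 s' y'.
    by rewrite /at0 scale_row_mx add_row_mx raddfD /= scale_scalar_mx.
  pose tail (y : 'rV[F]_(1 + m)) := \row_j y 0 (rshift 1 j).
  have at0_tail (y : 'rV[F]_(1 + m)) : at0 (y 0 0) (tail y) = y.
    rewrite -[RHS]hsubmxK /at0; congr row_mx; last by apply/rowP => j; rewrite !mxE.
    by apply/rowP => j; rewrite ord1 !mxE eqxx; congr (y 0 _); apply: val_inj.
  have [|a [L [size_L interp]]] := @lagrange_basis_exists d; first by lia.
  apply: eq_polyfun
    (_ : polyfun _ (fun y => \sum_i g (at0 (a i) (tail y)) * (L i).[y 0 0])).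
    move=> y; have [p size_p gp] := g_line (at0 0 (tail y)) (at0 1 0).
    have value s : g (at0 s (tail y)) = p.[s].
      by rewrite -gp -at0D add0r mulr1 scaler0 addr0.
    rewrite -[in RHS](at0_tail y) value (interp p size_p) horner_sum.
    by apply: eq_bigr => i _; rewrite value hornerZ.
  apply: polyfun_sum => i; rewrite mul2n -addnn; apply: polyfunM.
    apply: (polyfun_affine (h := fun x => g (at0 (a i) x))) => [|j];
      last exact: polyfun_coord.
    apply: IH => x u; have [p size_p gp] := g_line (at0 (a i) x) (at0 0 u).
    by exists p => // t; rewrite -gp -at0D mulr0 addr0.
  rewrite -[d in polyfun d]mul1n; apply: polyfun_horner => //.
  exact: polyfun_coord.
by have [p size_p gp] := g_line 0 u; exists p => // t; rewrite -gp add0r.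
Qed.

End PolyFun.

(** * Families of polynomials on lines *)

Section Lines.
Variables (F : finFieldType) (m : nat).
Local Notation V := 'rV[F]_m.
Implicit Types (x y a u v : V).

Lemma mem_line x u t : x + t *: u \in line x u.
Proof. by apply/imsetP; exists t. Qed.

Lemma line_refl x u : x \in line x u.
Proof. by have := mem_line x u 0; rewrite scale0r addr0. Qed.

Lemma line_inj x u : u != 0 -> injective (fun t : F => x + t *: u).
Proof.
move=> u0 t t' /addrI/eqP; rewrite -subr_eq0 -scalerBl scaler_eq0 (negbTE u0) orbF.
by rewrite subr_eq0 => /eqP.
Qed.

Lemma line_shift x u s : line (x + s *: u) u = line x u.
Proof.
apply/setP => y; apply/imsetP/imsetP => -[t _ ->].
  by exists (s + t) => //; rewrite scalerDl addrA.
by exists (t - s) => //; rewrite -addrA -scalerDl addrCA subrr addr0.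
Qed.

Lemma line_scale x u c : c != 0 -> line x (c *: u) = line x u.
Proof.
move=> c0; apply/setP => y; apply/imsetP/imsetP => -[t _ ->].
  by exists (t * c) => //; rewrite scalerA.
by exists (t / c) => //; rewrite scalerA divfK.
Qed.

Lemma line_eq_dir x u v : line x u = line x v -> exists c, u = c *: v.
Proof.
move=> eq_line; have := mem_line x u 1;
  rewrite eq_line scale1r => /imsetP[c _ /addrI eq_u].
by exists c.
Qed.

Lemma line_is_line x u : u != 0 -> is_line (line x u).
Proof. by move=> u0; apply/existsP; exists x; apply/existsP; exists u;
  rewrite u0 eqxx. Qed.

Lemma line_dir_neq0 x u : is_line (line x u) -> u != 0.
Proof.
case/existsP=> a /existsP[v /andP[v0 /eqP eq_line]];
  apply: contra_not_neq (negP v0) => u0.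
have mem_x t : a + t *: v = x.
  have := mem_line a v t; rewrite -eq_line => /imsetP[s _ ->].
  by rewrite u0 scaler0 addr0.
by have := mem_x 1; rewrite -(mem_x 0) scale0r scale1r => /addrI ->.
Qed.

Lemma lines_throughP x L :
  reflect (exists2 u, u != 0 & L = line x u) (L \in lines_through x).
Proof.
rewrite !inE; apply: (iffP andP) => [[/existsP[a /existsP[u /andP[u0 /eqP ->]]]]|].
  by case/imsetP => t _ ->; exists u; rewrite ?line_shift.
by move=> [u u0 ->]; split; [exact: line_is_line | exact: line_refl].
Qed.

Lemma pr_line (R : realFieldType) (A : pred V) x u :
  \pr_(t : F) A (x + t *: u) = #|[set y in line x u | A y]|%:R / #|line x u|%:R :> R.
Proof.
have [->|u0] := eqVneq u 0.
  have line0 : line x 0 = [set x].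
    apply/setP => y; rewrite inE; apply/imsetP/eqP => [[t _ ->]|->].
      by rewrite scaler0 addr0.
    by exists 0; rewrite ?scaler0 ?addr0.
  under eq_avg do rewrite scaler0 addr0.
  rewrite (avg_const 0) line0 cards1 divr1; congr _%:R.
  have -> : [set y in [set x] | A y] = if A x then [set x] else set0.
    apply/setP => y; rewrite !inE; have [->|xy] := eqVneq y x.
      by case: (A x); rewrite !inE ?eqxx.
    by case: (A x); rewrite !inE ?(negbTE xy).
  by case: (A x); rewrite ?cards1 ?cards0.
rewrite pr_card; congr (_%:R / _%:R); last by rewrite card_imset //; exact: line_inj.
rewrite -(card_imset _ (line_inj (x := x) u0)); apply: eq_card => y.
rewrite !inE; apply/imsetP/andP => [[t At ->]|[/imsetP[t _ ->] At]]; last by exists t.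
by rewrite mem_line.
Qed.

Definition poly_on_line (d : nat) (h : V -> F) x u : Prop :=
  exists2 p : {poly F}, (size p <= d.+1)%N & forall t, h (x + t *: u) = p.[t].

Lemma poly_on_line_eq d h x u a v :
  line x u = line a v -> poly_on_line d h a v -> poly_on_line d h x u.
Proof.
move=> eq_line [p size_p hp].
have : x \in line a v by rewrite -eq_line line_refl.
case/imsetP=> s _ def_x; have [c def_u] : exists c, u = c *: v.
  by apply: (@line_eq_dir x); rewrite eq_line def_x line_shift.
exists (p \Po (s%:P + c *: 'X)) => [|t].
  apply: leq_trans (size_comp_poly_leq _ _) _; rewrite ltnS.
  move: size_p (size_affine_poly s c); case: (size p) => [|k] //=.
  by case: (size _) => [|[|[|l]]] //= *; lia.
rewrite horner_comp !hornerE -hp def_x def_u scalerA -addrA -scalerDl.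
by rewrite [t * c]mulrC.
Qed.

Lemma extend_from_line x u (k : F -> F) : u != 0 ->
  exists h : V -> F, forall t, h (x + t *: u) = k t.
Proof.
move=> u0; exists (fun y => if [pick t | y == x + t *: u] is Some t then k t else 0) => t.
case: pickP => [t' /eqP/(line_inj u0) -> //|/(_ t)].
by rewrite eqxx.
Qed.

End Lines.

Section LinesFamilies.
Variables (F : finFieldType) (m : nat).
Local Notation V := 'rV[F]_m.
Implicit Types (P : V -> V -> {poly F}).

Definition lines_family (d : nat) P : Prop :=
  (forall x u, (size (P x u) <= d.+1)%N) /\
  (forall x u s t, (P (x + s *: u) u).[t] = (P x u).[s + t]).

Definition scaling_invariant P : Prop :=
  forall x u c t, c != 0 -> (P x (c *: u)).[t] = (P x u).[c * t].

Lemma lines_family_shift d P x u t : lines_family d P ->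
  (P (x + t *: u) u).[0] = (P x u).[t].
Proof. by case=> _ ->; rewrite addr0. Qed.

Lemma lines_family_of_oracle d (Phi : {set V} -> V -> F) :
  (forall x u, poly_on_line d (Phi (line x u)) x u) ->
  exists P, [/\ lines_family d P, scaling_invariant P &
    forall x u t, (P x u).[t] = Phi (line x u) (x + t *: u)].
Proof.
move=> polyPhi.
have /choice[p polyp] : forall xu : V * V, exists p : {poly F}, (size p <= d.+1)%N /\
    forall t, Phi (line xu.1 xu.2) (xu.1 + t *: xu.2) = p.[t].
  by move=> [x u]; have [p size_p Phip] := polyPhi x u; exists p.
exists (fun x u => p (x, u)).
have evalP x u t : (p (x, u)).[t] = Phi (line x u) (x + t *: u) by rewrite -(polyp _).2.
split=> // [|x u c t c0]; last by rewrite !evalP line_scale // scalerA mulrC.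
split=> [x u|x u s t]; first by case: (polyp (x, u)).
by rewrite !evalP line_shift scalerDl addrA.
Qed.

Definition plane_family (x u v : V) P (y w : 'rV[F]_2) : {poly F} :=
  P (plane_point x u v y) (lincomb2 u v w).

Variable R : realFieldType.

Definition best_fit (d : nat) (bad : V -> pred F) P : Prop :=
  forall x u (p : {poly F}), (size p <= d.+1)%N ->
    \pr_(t : F) bad (x + t *: u) (P x u).[t] <= \pr_(t : F) bad (x + t *: u) p.[t] :> R.

Lemma best_fit_exists (bad : V -> pred F) (d : nat) :
  exists2 P, lines_family d P & best_fit d bad P.
Proof.
pose cost (L : {set V}) (h : V -> F) := #|[set y in L | bad y (h y)]|.
pose admissible (L : {set V}) (h : V -> F) :=
  forall x u, L = line x u -> poly_on_line d h x u.
have /choice[Phi bestPhi] : forall L : {set V}, exists h : V -> F,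
    admissible L h /\ forall h', admissible L h' -> (cost L h <= cost L h')%N.
  move=> L; have adm0 : `[< admissible L (0%R : {ffun V -> F}) >].
    by apply/asboolP => x u _; exists 0; rewrite ?size_poly0 // => t;
      rewrite ffunE horner0.
  case: (@arg_minnP _ _ (fun h : {ffun V -> F} => `[< admissible L h >])
    (fun h : {ffun V -> F} => cost L h) adm0) => h /asboolP adm_h min_h.
  exists h; split=> // h' adm_h'; rewrite (_ : cost L h' = cost L [ffun y => h' y]).
    apply: min_h; apply/asboolP => x u defL.
    by have [p size_p hp] := adm_h' x u defL; exists p => // t; rewrite ffunE.
  by apply: eq_card => y; rewrite !inE ffunE.
have [|P [famP _ evalP]] := @lines_family_of_oracle d Phi.
  by move=> x u; exact: (bestPhi (line x u)).1.
exists P => // x u p size_p; under eq_avg do rewrite evalP.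
have best h : admissible (line x u) h ->
    \pr_(t : F) bad (x + t *: u) (Phi (line x u) (x + t *: u)) <=
    \pr_(t : F) bad (x + t *: u) (h (x + t *: u)) :> R.
  move=> adm_h; rewrite !(pr_line R (fun y => bad y (_ y))).
  by rewrite ler_wpM2r ?invr_ge0 ?ler0n // ler_nat (bestPhi _).2.
have [u0|u0] := eqVneq u 0; last first.
  have [h hp] := extend_from_line x (fun t => p.[t]) u0.
  under [leRHS]eq_avg do rewrite -hp.
  by apply: best => a v eq_line; apply: (poly_on_line_eq (esym eq_line)); exists p.
apply: ler_avg => t; move: (best (fun=> p.[t])); rewrite u0.
do 2![under eq_avg do rewrite scaler0 addr0; rewrite (avg_const 0)].
rewrite scaler0 addr0; apply=> a v _; exists (p.[t])%:P => [|s]; last by rewrite hornerC.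
by rewrite size_polyC (leq_trans (leq_b1 _)).
Qed.

Definition rejection (D : pred V) (f : V -> F) P : R :=
  \avg_(x : V) \pr_(u : V) (D x && (f x != (P x u).[0])).

Lemma rejection_ge0 D f P : 0 <= rejection D f P.
Proof. by apply: avg_ge0 => x; exact: pr_ge0. Qed.

Lemma le_rejection D D' f f' P : (forall x u, D x && (f x != (P x u).[0]) ->
    D' x && (f' x != (P x u).[0])) -> rejection D f P <= rejection D' f' P.
Proof. by move=> sub; apply: ler_avg => x; apply: le_pr => u; exact: sub. Qed.

Lemma rejection_lines d D f P : lines_family d P ->
  rejection D f P = \avg_(x : V) \avg_(u : V)
    \pr_(t : F) (D (x + t *: u) && (f (x + t *: u) != (P x u).[t])).
Proof.
move=> famP; rewrite /rejection.
rewrite -(avg_line_shift (fun x u => (D x && (f x != (P x u).[0]))%:R)).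
apply: eq_avg => x; apply: eq_avg => u; apply: eq_avg => t.
by rewrite (lines_family_shift _ _ _ famP).
Qed.

End LinesFamilies.

Section PlaneFamilies.
Variables (R : realFieldType) (F : finFieldType) (m : nat).
Local Notation V := 'rV[F]_m.
Local Notation q := (#|F|%:R : R).
Implicit Types (P : V -> V -> {poly F}) (x u v : V).

Lemma lines_family_plane d P x u v :
  lines_family d P -> lines_family d (plane_family x u v P).
Proof.
by move=> [sizeP shiftP]; split=> [y w|y w s t]; rewrite /plane_family ?plane_point_line.
Qed.

Lemma best_fit_plane d (bad : V -> pred F) P x u v : best_fit R d bad P ->
  best_fit R d (bad \o plane_point x u v) (plane_family x u v P).
Proof.
move=> bestP y w p size_p; have := bestP (plane_point x u v y) (lincomb2 u v w) p size_p.
by under eq_avg do rewrite -plane_point_line;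
  under [leRHS]eq_avg do rewrite -plane_point_line.
Qed.

Lemma rejection_plane_le (D : pred V) f P x :
  \avg_(u : V) \avg_(v : V) rejection R (D \o plane_point x u v) (f \o plane_point x u v)
    (plane_family x u v P) <= rejection R D f P + 2 / q.
Proof.
have := avg_planes_dist
  (fun a c => indicator_in01 R (D (x + a) && (f (x + a) != (P (x + a) c).[0]))).
move/ler_distlDr/le_trans; apply; rewrite lerD2r.
by rewrite (avg_addl (fun y => \pr_(c : V) (D y && (f y != (P y c).[0])))).
Qed.

End PlaneFamilies.

Section LineRigidity.
Variables (R : realFieldType) (F : finFieldType) (m : nat).
Local Notation V := 'rV[F]_m.
Local Notation q := (#|F|%:R : R).

Lemma polyfun_eq_on_line d (h : V -> F) (p : {poly F}) x u : polyfun d h ->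
  (size p <= d.+1)%N -> d%:R / q < \pr_(t : F) (p.[t] == h (x + t *: u)) ->
  forall t, p.[t] = h (x + t *: u).
Proof.
move=> /(polyfun_line x u)[r size_r hr] size_p dense t; rewrite hr; congr (_.[t]).
by apply: (poly_eq_pr size_p size_r dense) => s /eqP; rewrite hr.
Qed.

Lemma pr_polyfun_eq_le d (g h : V -> F) (z : V) :
  polyfun d g -> polyfun d h -> g z != h z -> \pr_(y : V) (g y == h y) <= (d.+1)%:R / q.
Proof.
move=> poly_g poly_h gh; have q_gt0 := card_field_gt0 R F.
have := avg_cone_dist z (fun y => indicator_in01 R (g y == h y)).
rewrite distrC => /ler_distlDr/le_trans; apply.
rewrite -natr1 mulrDl mul1r lerD2r; apply: (avg_le 0) => u.
rewrite leNgt; apply: contra gh => dense.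
have [p size_p gp] := polyfun_line z u poly_g.
rewrite -[z]addr0 -(scale0r u) gp (polyfun_eq_on_line (x := z) (u := u) poly_h size_p) //.
by under eq_avg do rewrite -gp.
Qed.

Lemma line_rigidity d (S : pred V) (h : V -> F) (H : V -> V -> {poly F})
    (s := \pr_(x : V) S x : R) :
  polyfun d h -> lines_family d H -> 0 < s -> 4 * d%:R < s * q ->
  \avg_(x : V) \pr_(u : V) [exists t, (H x u).[t] != h (x + t *: u)] <=
    4 / s * (q^-1 + rejection R S h H).
Proof.
move=> poly_h famH s_gt0 small_d; have q_gt0 := card_field_gt0 R F.
pose err x u : R := \pr_(t : F) (S (x + t *: u) && (h (x + t *: u) != (H x u).[t])).
have bound x u : [exists t, (H x u).[t] != h (x + t *: u)]%:R <=
    (line_density R S x u < s / 2)%R%:R + 4 / s * err x u.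
  have err_ge0 : 0 <= 4 / s * err x u.
    by apply: mulr_ge0 (pr_ge0 _ _); rewrite divr_ge0 // ltW.
  case: existsP => [[t neq_t]|_]; last by rewrite addr_ge0.
  case: ltP => [_|dense] /=; first by rewrite lerDl.
  rewrite add0r leNgt; apply: contraNN neq_t => small_err; apply/eqP.
  apply: (polyfun_eq_on_line poly_h (famH.1 x u)).
  apply: (@lt_le_trans _ _ (line_density R S x u - err x u)).
    have : err x u < s / 4.
      by move: small_err; rewrite mulrAC ltr_pdivrMr // mul1r; lra.
    have : d%:R / q < s / 4 by rewrite ltr_pdivrMr //; lra.
    by lra.
  rewrite lerBlDr; apply: le_pr_or => t'; rewrite [h _ == _]eq_sym.
  by case: (S _); case: (_ == _).
apply: (@le_trans _ _ (\avg_(x : V) \avg_(u : V)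
    ((line_density R S x u < s / 2)%R%:R + 4 / s * err x u))).
  by apply: ler_avg => x; apply: ler_avg => u; exact: bound.
under eq_avg do rewrite avgD avgZ.
rewrite avgD avgZ (rejection_lines _ _ _ famH) mulrDr lerD2r.
by have := line_sampling s_gt0; rewrite invfM mulrA.
Qed.

End LineRigidity.

(** * The line test in a plane *)

Section Pruning.
Variables (R : realFieldType) (T : finType).
Implicit Types (A B : {set T}).

Definition fibre (X : eqType) (f : T -> X) A e : {set T} := [set e' in A | f e' == f e].

Definition excess (X Y : finType) (f : T -> X) (g : T -> Y) (a b : R) A : R :=
  #|A|%:R - a * #|f @: A|%:R - b * #|g @: A|%:R.

Lemma excessC (X Y : finType) (f : T -> X) (g : T -> Y) (a b : R) A :
  excess f g a b A = excess g f b a A.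
Proof. by rewrite /excess addrAC. Qed.

Lemma excess_remove_fibre (X Y : finType) (f : T -> X) (g : T -> Y) (a b : R) A e :
  0 <= a -> 0 <= b -> e \in A -> #|fibre f A e|%:R < a ->
  excess f g a b A < excess f g a b (A :\: fibre f A e).
Proof.
move=> a_ge0 b_ge0 eA small; set A' := A :\: _.
have cardA : #|A|%:R = #|fibre f A e|%:R + #|A'|%:R :> R.
  rewrite -natrD -(cardsID (fibre f A e) A); congr (_ + _)%:R; congr #|pred_of_set _|.
  by apply/setIidPr/subsetP => e'; rewrite inE => /andP[].
have f_image : #|f @: A'|%:R + 1 <= #|f @: A|%:R :> R.
  rewrite natr1 ler_nat; apply: proper_card; apply/properP; split.
    by apply: imsetS; apply: subsetDl.
  exists (f e); first exact: imset_f.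
  by apply/imsetP => -[e']; rewrite !inE => /andP[+ e'A] eq_f; rewrite e'A eq_f eqxx.
have g_image : #|g @: A'|%:R <= #|g @: A|%:R :> R.
  by rewrite ler_nat subset_leq_card // imsetS // subsetDl.
have := ler_wpM2l a_ge0 f_image; have := ler_wpM2l b_ge0 g_image.
by rewrite /excess cardA; lra.
Qed.

(* A maximiser of the excess has no small fibre, as removing one would increase it. *)
Lemma pruning (X Y : finType) (f : T -> X) (g : T -> Y) (a b : R) A :
  0 <= a -> 0 <= b -> a * #|f @: A|%:R + b * #|g @: A|%:R < #|A|%:R ->
  exists B, [/\ B \subset A, B != set0,
    forall e, e \in B -> a <= #|fibre f B e|%:R &
    forall e, e \in B -> b <= #|fibre g B e|%:R].
Proof.
move=> a_ge0 b_ge0 large.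
case: (@arg_maxP _ R _ A (fun B => B \subset A) (excess f g a b) (subxx A)) => B sBA maxB.
have maxBD C : excess f g a b (B :\: C) <= excess f g a b B.
  by apply: maxB; apply: subset_trans sBA; apply: subsetDl.
exists B; split=> // [|e eB|e eB].
- apply: contraTneq (maxB A (subxx A)) => ->.
  by rewrite -ltNge /excess !imset0 !cards0 mulr0n !mulr0 !subr0; lra.
- rewrite leNgt; apply: contraTN (maxBD (fibre f B e)) => small.
  by rewrite -ltNge excess_remove_fibre.
- rewrite leNgt; apply: contraTN (maxBD (fibre g B e)) => small.
  by rewrite -ltNge ![excess f g _ _ _]excessC excess_remove_fibre.
Qed.

Lemma leq_card_imset_fibre (X : finType) (f : T -> X) A k :
  (forall e, e \in A -> (k <= #|fibre f setT e|)%N) -> (k * #|f @: A| <= #|T|)%N.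
Proof.
move=> large; apply: leq_trans (max_card [pred e | f e \in f @: A]).
rewrite -[leqRHS]sum1_card (partition_big f (mem (f @: A))) //= mulnC -sum_nat_const.
apply: leq_sum => _ /imsetP[e eA ->]; apply: leq_trans (large e eA) _.
rewrite -sum1_card; apply: eq_leq; apply: eq_bigl => e'; rewrite !inE /=.
by apply/idP/andP => [/eqP eq_f|[]//]; rewrite -eq_f eqxx eq_f imset_f.
Qed.

End Pruning.

Section DenseCore.
Variables (R : realFieldType) (F : finFieldType) (m : nat).
Local Notation V := 'rV[F]_m.
Local Notation q := (#|F|%:R : R).
Implicit Types (E : {set V * V}) (x u : V).

Definition dense_core (tau : R) E : Prop :=
  [/\ E != set0,
    forall x u, (x, u) \in E -> tau <= \pr_(v : V) ((x, v) \in E) &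
    forall x u, (x, u) \in E -> tau <= \pr_(t : F) ((x + t *: u, u) \in E)].

Definition directed_line (p : V * V) : {set V} * V := (line p.1 p.2, p.2).

Lemma card_fibre_point E x u :
  #|fibre fst E (x, u)|%:R = #|{: V}|%:R * \pr_(v : V) ((x, v) \in E) :> R.
Proof.
rewrite pr_card mulrCA divff ?mulr1; last by rewrite pnatr_eq0 -lt0n; apply/card_gt0P;
  exists 0.
congr _%:R; rewrite -[RHS](card_imset _ (f := fun v : V => (x, v))) => [|v v' [] //].
apply: eq_card => -[y v]; rewrite !inE; apply/andP/imsetP => [[yvE /eqP /= def_y]|].
  by exists v; rewrite ?unfold_in -?def_y.
by move=> [v' v'E [-> ->]].
Qed.

Lemma card_fibre_line E x u : u != 0 ->
  #|fibre directed_line E (x, u)|%:R = q * \pr_(t : F) ((x + t *: u, u) \in E) :> R.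
Proof.
move=> u0; rewrite pr_card mulrCA divff ?mulr1 ?gt_eqF ?card_field_gt0 //; congr _%:R.
have inj : injective (fun t : F => (x + t *: u, u)) by move=> t t' [] /(line_inj u0).
rewrite -(card_imset _ inj); apply: eq_card => -[y v]; rewrite !inE.
apply/andP/imsetP => [[yvE /eqP[eq_line def_v]]|[t tE [-> ->]]]; last first.
  by rewrite /directed_line /= line_shift.
have : y \in line x u by rewrite -eq_line line_refl.
by case/imsetP=> t _ def_y; exists t; rewrite ?unfold_in /= -def_y -[u]def_v.
Qed.

Lemma dense_core_exists (E : rel V) (tau : R) : 0 <= tau ->
  2 * tau + #|{: V}|%:R^-1 < \avg_(x : V) \pr_(u : V) E x u ->
  exists2 A, dense_core tau A & forall x u, (x, u) \in A -> E x u.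
Proof.
move=> tau_ge0 dense; pose E0 := [set p : V * V | E p.1 p.2 & p.2 != 0].
have N_gt0 : (0 : R) < #|{: V}|%:R by rewrite ltr0n; apply/card_gt0P; exists 0.
have q_gt0 := card_field_gt0 R F.
have card_E0 : 2 * tau * #|{: V}|%:R ^+ 2 < #|E0|%:R.
  have : \avg_(x : V) \pr_(u : V) E x u <=
      \avg_(x : V) (\pr_(u : V) ((x, u) \in E0) + \pr_(u : V) (u == 0)) :> R.
    apply: ler_avg => x; apply: le_pr_or => u; rewrite inE /=.
    by case: (E x u); case: (u == 0).
  rewrite avgD (avg_const 0) pr_pred1 (avg_pair (fun x u => ((x, u) \in E0)%:R)).
  rewrite pr_card card_prod natrM -expr2.
  rewrite (eq_card (B := E0)) => [E_le|[x u] //].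
  by rewrite -ltr_pdivlMr ?exprn_gt0 //; lra.
have points_le : #|fst @: E0|%:R <= #|{: V}|%:R :> R by rewrite ler_nat max_card.
have lines_le : q * #|directed_line @: E0|%:R <= #|{: V}|%:R ^+ 2.
  rewrite expr2 -!natrM ler_nat -card_prod; apply: leq_card_imset_fibre => -[x u].
  rewrite inE /= => /andP[_ u0]; rewrite -(ler_nat R) card_fibre_line //.
  by under eq_avg do rewrite inE; rewrite (avg_const 0) mulr1.
have [|||A [sAE A0 point_deg line_deg]] := @pruning R _ _ _ fst directed_line
    (tau * #|{: V}|%:R) (tau * q) E0.
- by rewrite mulr_ge0 ?ler0n.
- by rewrite mulr_ge0 ?ler0n.
- apply: le_lt_trans card_E0.
  rewrite -mulrA -[X in _ + X]mulrA -mulrDr -mulrA [leRHS]mulrCA.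
  by rewrite ler_wpM2l // mulrDl mul1r lerD // expr2 ler_wpM2l // ltW.
have A_E0 x u : (x, u) \in A -> E x u && (u != 0).
  by move=> /(subsetP sAE); rewrite inE.
exists A => [|x u /A_E0/andP[] //]; split=> // x u xuA.
- by have := point_deg _ xuA; rewrite card_fibre_point mulrC ler_pM2l.
- have /andP[_ u0] := A_E0 x u xuA.
  by have := line_deg _ xuA; rewrite card_fibre_line // mulrC ler_pM2l.
Qed.

End DenseCore.

Section CorePolynomial.
Variables (R : realFieldType) (F : finFieldType) (n d D : nat) (tau : R).
Local Notation q := (#|F|%:R : R).
Local Notation V := 'rV[F]_n.

Definition graph_weight : 'I_n.+1 -> nat := fcons d (fun=> 1%N).

Variables (f : V -> F) (P : V -> V -> {poly F}) (E : {set V * V}).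
Hypothesis famP : lines_family d P.
Hypothesis fP : forall x u, (x, u) \in E -> f x = (P x u).[0].
Hypothesis coreE : dense_core tau E.
Hypothesis D_lt : D%:R < tau * q.

Definition graph_over_core (z : 'I_n.+1 -> F) : Prop :=
  exists x u, (x, u) \in E /\ z = fcons (f x) (x 0).

Section Vanishing.
Variable A : {mpoly F[n.+1]}.
Hypothesis weightA : (mmeasure (weight graph_weight) A <= D.+1)%N.
Hypothesis vanishA : forall z, graph_over_core z -> A.@[z] = 0.

Lemma vanishing_on_core_line x u : (x, u) \in E ->
  subst_poly (fcons (P x u) (line_param x u)) A = 0.
Proof.
move=> xuE; have [_ _ /(_ x u xuE) line_deg] := coreE.
apply: (poly_eq_pr (R := R) (d := D) (S := fun t => (x + t *: u, u) \in E)).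
- apply: leq_trans weightA; apply: size_subst_poly => i; rewrite /= weight1 /graph_weight.
  by case: (unliftP ord0 i) => [j|] ->; rewrite ?fconsS ?fcons0 ?size_affine_poly ?famP.1.
- by rewrite size_poly0.
- by apply: lt_le_trans line_deg; rewrite ltr_pdivrMr ?card_field_gt0.
- move=> t xtuE; rewrite horner0 horner_subst_graph.
  rewrite -(lines_family_shift _ _ _ famP) -fP //.
  by apply: vanishA; exists (x + t *: u), u.
Qed.

Lemma gradient_orthogonal x u : A^`M(ord0) = 0 -> (x, u) \in E ->
  \sum_j (A^`M(lift ord0 j)).@[fcons (f x) (x 0)] * u 0 j = 0.
Proof.
move=> dA0 xuE.
have := congr1 (fun p : {poly F} => p^`().[0]) (vanishing_on_core_line xuE).
rewrite /= deriv0 horner0 deriv_subst_poly big_ord_recl dA0 rmorph0 mul0r add0r.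
rewrite horner_sum => sum0; rewrite -[RHS]sum0; apply: eq_bigr => j _.
rewrite hornerM horner_subst_graph scale0r addr0 -fP // fconsS /line_param.
by rewrite derivD derivC derivZ derivX add0r alg_polyC hornerC.
Qed.

Lemma gradient_eq0 x u j : 1 < tau * q -> A^`M(ord0) = 0 -> (x, u) \in E ->
  (A^`M(lift ord0 j)).@[fcons (f x) (x 0)] = 0.
Proof.
move=> tau_q dA0 xuE; have [_ /(_ x u xuE) point_deg _] := coreE.
apply: contraTeq point_deg => grad_j; rewrite -ltNge.
apply: (@le_lt_trans _ _ q^-1); last by rewrite -[q^-1]mul1r ltr_pdivrMr ?card_field_gt0.
rewrite -(pr_hyperplane R (i := j) (a := fun j => _) grad_j).
by apply: le_pr => v xvE; rewrite gradient_orthogonal.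
Qed.

End Vanishing.

Lemma simple_root_over_core A : 1 < tau * q ->
  (mmeasure (weight graph_weight) A <= D.+1)%N -> derivative_minimal graph_over_core A ->
  exists x u, (x, u) \in E /\ A^`M(ord0).@[fcons (f x) (x 0)] != 0.
Proof.
move=> tau_q weightA [vanishA minA [i dAi]]; apply: contrapT => no_root.
have dA0 : A^`M(ord0) = 0.
  apply: minA => _ [x [u [xuE ->]]]; apply: contrapT => /eqP dA_x.
  by apply: no_root; exists x, u.
case/eqP: dAi; case: (unliftP ord0 i) => [j ->|->] //.
apply: minA => _ [x [u [xuE ->]]].
exact: (gradient_eq0 weightA vanishA _ tau_q dA0 xuE).
Qed.

Theorem polyfun_through_core_point A : 1 < tau * q -> A != 0 ->
  (mmeasure (weight graph_weight) A <= D.+1)%N ->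
  (forall z, graph_over_core z -> A.@[z] = 0) ->
  exists2 h, polyfun d h & exists x u, (x, u) \in E /\
    forall v, (x, v) \in E -> forall t, (P x v).[t] = h (x + t *: v).
Proof.
move=> tau_q A0 weightA vanishA.
have nonempty : exists z, graph_over_core z.
  by have [/set0Pn[[x u] xuE] _ _] := coreE; exists (fcons (f x) (x 0)), x, u.
have [B weightB minB] :=
  derivative_minimal_exists (weight graph_weight) nonempty A0 vanishA.
have {}weightB := leq_trans weightB weightA.
have [x [u [xuE simple]]] := simple_root_over_core tau_q weightB minB.
have [Q degQ branch] := hensel_lines d simple.
exists (mpeval Q); first by exists Q.
exists x, u; split=> // v xvE t; rewrite /mpeval -horner_subst_line; congr (_.[t]).
have [vanishB _ _] := minB; have sizeQ := leq_trans (size_subst_line x v Q) degQ.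
apply/polyP => i; have [id|id] := leqP i d.
  by apply: (branch v) => //; rewrite ?(vanishing_on_core_line weightB vanishB) -?fP.
by rewrite !nth_default // (leq_trans _ id) ?famP.1.
Qed.

End CorePolynomial.

Section PlaneTest.
Variables (R : archiRealFieldType) (F : finFieldType).
Local Notation q := (#|F|%:R : R).
Local Notation W := 'rV[F]_2.

Definition box_monomial k n (p : 'I_k * ('I_n * 'I_n)) : 'X_{1..3} :=
  [multinom [tuple nat_of_ord p.1; nat_of_ord p.2.1; nat_of_ord p.2.2]].

Lemma box_monomial_inj k n : injective (@box_monomial k n).
Proof.
move=> [c [a b]] [c' [a' b']] eq_mon.
have eq_nth i := congr1 (fun m : 'X_{1..3} => nth 0%N m i) eq_mon.
by move: (eq_nth 0%N) (eq_nth 1%N) (eq_nth 2) => /= /val_inj -> /val_inj -> /val_inj ->.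
Qed.

Lemma weight_box_monomial k n d (p : 'I_k * ('I_n * 'I_n)) :
  (weight (graph_weight d) (box_monomial p) <= k.-1 * d + 2 * n.-1)%N.
Proof.
rewrite /weight /graph_weight !big_ord_recl big_ord0 fcons0 !fconsS.
rewrite /fun_of_multinom /= !(tnth_nth 0%N) /= !muln1 addn0.
case: p => [[c lt_c] [[a lt_a] [b lt_b]]] /=.
have cd_le : (c * d <= k.-1 * d)%N by rewrite leq_mul2r -ltnS (ltn_predK lt_c) lt_c orbT.
by move: cd_le lt_a lt_b; lia.
Qed.

Lemma plane_graph_vanishing (f : W -> F) (d : nat) (eps : R) :
  0 < eps -> eps <= 1 -> 72 * d%:R <= eps ^+ 3 * q ->
  exists (D : nat) (A : {mpoly F[3]}), [/\ D%:R < 2 * eps * q, A != 0,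
    (mmeasure (weight (graph_weight d)) A <= D.+1)%N &
    forall x, A.@[fcons (f x) (x 0)] = 0].
Proof.
move=> eps_gt0 eps_le1 small_d; have q_gt0 := card_field_gt0 R F.
pose n := (Num.truncn (eps * q / 2)).+1; pose k := (Num.truncn (4 / eps ^+ 2)).+1.
have n_ge0 : 0 <= eps * q / 2 by rewrite divr_ge0 // mulr_ge0 // ltW.
have k_ge0 : 0 <= 4 / eps ^+ 2 by rewrite divr_ge0 // exprn_ge0 // ltW.
have /andP[n_le n_gt] : n.-1%:R <= eps * q / 2 < n%:R by exact: truncn_itv.
have /andP[k_le k_gt] : k.-1%:R <= 4 / eps ^+ 2 < k%:R by exact: truncn_itv.
pose s := [seq box_monomial p | p : 'I_k * ('I_n * 'I_n)].
have uniq_s : uniq s by rewrite map_inj_uniq ?enum_uniq //; exact: box_monomial_inj.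
have [|A [A0 suppA vanishA]] :=
    @vanishing_mpoly_exists F 3 _ (fun x : W => fcons (f x) (x 0)) s uniq_s.
  rewrite size_map -cardE !card_prod !card_ord card_mx mul1n -(ltr_nat R) natrX !natrM.
  have -> : q ^+ 2 = 4 / eps ^+ 2 * (eps * q / 2 * (eps * q / 2)).
    by field; rewrite gt_eqF.
  by apply: ltr_pM => //; [exact: mulr_ge0 | exact: ltr_pM].
exists (k.-1 * d + 2 * n.-1)%N, A; split=> //; last first.
  rewrite mmeasureE; apply/bigmax_leqP_seq => m /suppA/mapP[p _ ->] _.
  exact: weight_box_monomial.
rewrite natrD !natrM.
have kd_le : k.-1%:R * d%:R <= eps * q / 18.
  apply: (@le_trans _ _ (4 / eps ^+ 2 * d%:R)); first by rewrite ler_wpM2r.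
  have -> : eps * q / 18 = 4 / eps ^+ 2 * (eps ^+ 3 * q / 72).
    by field; rewrite gt_eqF.
  by rewrite ler_wpM2l //; lra.
have : 0 < eps * q by rewrite mulr_gt0.
by lra.
Qed.

(* The core lines through a core point x sweep out many core points. *)
Lemma core_agreement m (tau : R) (A : {set 'rV[F]_m * 'rV[F]_m}) (S : pred 'rV[F]_m) x u :
  0 <= tau -> dense_core tau A -> (x, u) \in A ->
  (forall v t, (x, v) \in A -> (x + t *: v, v) \in A -> S (x + t *: v)) ->
  tau ^+ 2 <= \pr_(y : 'rV[F]_m) S y + q^-1.
Proof.
move=> tau_ge0 [_ point_deg line_deg] xuA sub.
apply: le_trans (avg_cone_le x (fun y => indicator_in01 R (S y))).
apply: (@le_trans _ _ (\avg_(v : 'rV[F]_m) (tau * ((x, v) \in A)%:R))).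
  by rewrite avgZ expr2 ler_wpM2l // (point_deg x u).
apply: ler_avg => v; case: (boolP ((x, v) \in A)) => xvA; last by rewrite mulr0 pr_ge0.
rewrite mulr1; apply: le_trans (line_deg x v xvA) _.
by apply: le_pr => t; exact: sub.
Qed.

Theorem plane_test (d : nat) (f : W -> F) (P : W -> W -> {poly F})
    (E : rel W) (eps : R) :
  (0 < d)%N -> 0 < eps -> eps <= 1 -> 72 * d%:R <= eps ^+ 3 * q ->
  lines_family d P -> (forall x u, E x u -> f x = (P x u).[0]) ->
  5 * eps <= \avg_(x : W) \pr_(u : W) E x u ->
  exists h, [/\ polyfun d h,
    exists x u, E x u /\ forall t, (P x u).[t] = h (x + t *: u) &
    eps ^+ 2 <= \pr_(y : W) ([exists u, E y u] && (f y == h y))].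
Proof.
move=> d_gt0 eps_gt0 eps_le1 small_d famP fP accept; have q_gt0 := card_field_gt0 R F.
have qV : q^-1 <= eps ^+ 3 / 72.
  have d_ge1 : (1 : R) <= d%:R by rewrite ler1n.
  by rewrite -[q^-1]mul1r ler_pdivrMr //; lra.
have eps2 : eps ^+ 2 <= eps by rewrite expr2 ger_pMl.
have eps3 : eps ^+ 3 <= eps ^+ 2 by rewrite exprS ger_pMl // exprn_gt0.
have [||A coreA sAE] := @dense_core_exists R F 2 E (2 * eps).
- by rewrite mulr_ge0 // ltW.
- by have := inv_card_rV_le R F 1; lra.
have fPA x u : (x, u) \in A -> f x = (P x u).[0] by move/sAE/fP.
have [D [B [D_lt B0 weightB vanishB]]] := plane_graph_vanishing f eps_gt0 eps_le1 small_d.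
have [||h poly_h [x [u [xuA eq_h]]]] :=
  polyfun_through_core_point famP fPA coreA D_lt _ B0 weightB.
- by rewrite -ltr_pdivrMr // div1r; lra.
- by move=> _ [x [u [_ ->]]].
exists h; split=> //; first by exists x, u; split; [exact: sAE | exact: eq_h].
have := @core_agreement 2 (2 * eps) A (fun y => [exists u, E y u] && (f y == h y)) x u.
move=> /(_ _ coreA xuA) agree; suff : (2 * eps) ^+ 2 <= \pr_(y : W)
    ([exists u, E y u] && (f y == h y)) + q^-1.
  by have := sqr_ge0 eps; rewrite exprMn; lra.
apply: agree => [|v t xvA xtvA]; first by rewrite mulr_ge0 // ltW.
rewrite -eq_h // (fPA _ _ xtvA) (lines_family_shift _ _ _ famP) eqxx andbT.
by apply/existsP; exists v; exact: sAE.
Qed.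

End PlaneTest.

Section PlaneRigidity.
Variables (R : archiRealFieldType) (F : finFieldType).
Local Notation W := 'rV[F]_2.
Local Notation q := (#|F|%:R : R).
Implicit Types (f g : W -> F) (H : W -> W -> {poly F}).

Lemma partial_plane_agreement d (D : pred W) f H (a : R) :
  (0 < d)%N -> lines_family d H -> 0 < a -> a <= 1 -> 72 * 1000 * d%:R <= a ^+ 3 * q ->
  a <= \pr_(y : W) D y -> rejection R D f H <= a / 2 ->
  exists2 h, polyfun d h & a ^+ 2 / 100 <= \pr_(y : W) (D y && (f y == h y)).
Proof.
move=> d_gt0 famH a_gt0 a_le1 small_d denseD small_rej.
pose E y w := D y && (f y == (H y w).[0]).
have acceptE : 5 * (a / 10) <= \avg_(y : W) \pr_(w : W) E y w.
  apply: (@le_trans _ _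
    (\avg_(y : W) ((D y)%:R - \pr_(w : W) (D y && (f y != (H y w).[0]))))).
    by rewrite avgB -/(rejection R D f H); lra.
  apply: ler_avg => y; rewrite -[X in X - _](avg_const (0 : W)) lerBlDr.
  by apply: le_pr_or => w; rewrite /E; case: (D y); case: (f y == _).
have [||||h [poly_h _ agree]] :=
    @plane_test R F d f H E (a / 10) d_gt0 _ _ _ famH _ acceptE.
- by rewrite divr_gt0.
- by lra.
- have -> : (a / 10) ^+ 3 * q = a ^+ 3 * q / 1000 by field.
  by lra.
- by move=> y w /andP[_ /eqP].
exists h => //; have -> : a ^+ 2 / 100 = (a / 10) ^+ 2 by field.
by apply: (le_trans agree); apply: le_pr => y /andP[/existsP[w /andP[-> _]] ->].
Qed.

Lemma partial_plane_rigidity d (D : pred W) f H (a : R) (b := rejection R D f H) :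
  (0 < d)%N -> lines_family d H -> 0 < a -> a <= 1 -> 72 * 1000 * d%:R <= a ^+ 3 * q ->
  a <= \pr_(y : W) D y -> b <= a / 2 ->
  exists2 h, polyfun d h &
    \avg_(y : W) \pr_(w : W) [exists t, (H y w).[t] != h (y + t *: w)] <=
      400 * (q^-1 + b) / a ^+ 2.
Proof.
move=> d_gt0 famH a_gt0 a_le1 small_d denseD small_b.
have [h poly_h denseS] :=
  partial_plane_agreement d_gt0 famH a_gt0 a_le1 small_d denseD small_b.
exists h => //; pose S y := D y && (f y == h y).
set s := \pr_(y : W) _ in denseS.
have q_gt0 := card_field_gt0 R F; have d_pos : (0 : R) < d%:R by rewrite ltr0n.
have a2_gt0 : 0 < a ^+ 2 by rewrite exprn_gt0.
have s_gt0 : 0 < s by apply: lt_le_trans denseS; rewrite divr_gt0.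
have small_ds : 4 * d%:R < s * q.
  have : a ^+ 3 * q <= 100 * s * q; last by lra.
  rewrite ler_pM2r //; have : a ^+ 3 <= a ^+ 2 by rewrite exprS ger_pMl.
  by lra.
apply: le_trans (line_rigidity (S := S) poly_h famH s_gt0 small_ds) _; rewrite -/s.
have rejS : rejection R S h H <= b.
  by apply: le_rejection => y w /andP[/andP[-> /eqP <-]].
have b_ge0 : 0 <= b := rejection_ge0 _ _ _ _.
apply: (@le_trans _ _ (4 / s * (q^-1 + b))).
  by rewrite ler_wpM2l ?lerD2l // divr_ge0 // ltW.
have -> : 400 * (q^-1 + b) / a ^+ 2 = 4 / (a ^+ 2 / 100) * (q^-1 + b).
  by field; rewrite !gt_eqF.
rewrite ler_wpM2r ?addr_ge0 ?(ltW (invq_gt0 R F)) //.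
by rewrite ler_pM2l // lef_pV2 // posrE divr_gt0.
Qed.

Lemma total_plane_agreement d g H (b := rejection R predT g H) :
  (0 < d)%N -> lines_family d H -> 72 * 1000 * d%:R <= q ->
  exists2 h, polyfun d h & \pr_(y : W) (g y != h y) <= 401 * (b + q^-1).
Proof.
move=> d_gt0 famH small_d; have qV_gt0 := invq_gt0 R F.
have [small_b|large_b] := leP b (1 / 2); last first.
  exists (fun=> 0); first exact: polyfun_const.
  by apply: le_trans (pr_le1 _ _) _; lra.
have [||h poly_h bad_lines] :=
    @partial_plane_rigidity d predT g H 1 d_gt0 famH ltr01 (lexx _) _ _ small_b.
- by rewrite expr1n mul1r.
- by rewrite (avg_const 0).
exists h => //; rewrite expr1n divr1 -/b in bad_lines.
have : \pr_(y : W) (g y != h y) <= \avg_(y : W) (\pr_(w : W) (g y != (H y w).[0]) +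
    \pr_(w : W) [exists t, (H y w).[t] != h (y + t *: w)]) :> R.
  apply: ler_avg => y; rewrite -[leLHS](avg_const (0 : W)); apply: le_pr_or => w neq_gh.
  have [eq_gH|//] := eqVneq (g y) (H y w).[0].
  by apply/existsP; exists 0; rewrite -eq_gH scale0r addr0.
by rewrite avgD -[X in X + _]/b; lra.
Qed.

Lemma plane_best_fit d g H (b := rejection R predT g H) :
  (0 < d)%N -> lines_family d H -> 72 * 1000 * d%:R <= q ->
  best_fit R d (fun y z => g y != z) H ->
  exists2 h, polyfun d h & forall y0 : W,
    \avg_(w : W) \pr_(t : F) (g (y0 + t *: w) != (H y0 w).[t]) <= 402 * (b + q^-1) /\
    \pr_(w : W) ((H y0 w).[0] != h y0) <= 1608 * (b + q^-1).
Proof.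
move=> d_gt0 famH small_d fitH; have q_gt0 := card_field_gt0 R F.
have [h poly_h agree] := total_plane_agreement g d_gt0 famH small_d; rewrite -/b in agree.
have b_ge0 : 0 <= b := rejection_ge0 _ _ _ _; have qV_gt0 := invq_gt0 R F.
exists h => // y0; pose e w : R := \pr_(t : F) (g (y0 + t *: w) != h (y0 + t *: w)).
have avg_e : avg e <= 402 * (b + q^-1).
  by have := avg_cone_le y0 (fun y => indicator_in01 R (g y != h y));
    rewrite -/(avg e); lra.
have fit_e w : \pr_(t : F) (g (y0 + t *: w) != (H y0 w).[t]) <= e w.
  have [p size_p hp] := polyfun_line y0 w poly_h.
  by apply: le_trans (fitH y0 w p size_p) _; apply: le_pr => t; rewrite hp.
split; first by apply: le_trans avg_e; apply: ler_avg.
apply: (@le_trans _ _ (4 * avg e)); last by lra.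
rewrite -avgZ; apply: ler_avg => w; have e_ge0 : 0 <= e w := pr_ge0 _ _.
case: eqP => [_|neq] /=; first by rewrite mulr_ge0.
rewrite leNgt; apply/negP => small_e; case: neq.
rewrite -[y0 in h y0]addr0 -(scale0r w);
  apply: polyfun_eq_on_line poly_h (famH.1 _ _) _ _.
apply: (@lt_le_trans _ _ (1 - 2 * e w)).
  by have := ratio_card_field_le _ small_d; lra.
have := pr_not R 0 (fun t => (H y0 w).[t] == h (y0 + t *: w)).
have : \pr_(t : F) ((H y0 w).[t] != h (y0 + t *: w)) <=
    \pr_(t : F) (g (y0 + t *: w) != (H y0 w).[t]) + e w.
  apply: le_pr_or => t; rewrite [g _ == _]eq_sym.
  by have [<-|//] := eqVneq (H y0 w).[t] (g (y0 + t *: w)).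
by have := fit_e w; lra.
Qed.

End PlaneRigidity.

(** * The line test close to acceptance *)

Section TransverseDirections.
Variables (R : realFieldType) (F : finFieldType).
Local Notation W := 'rV[F]_2.
Local Notation q := (#|F|%:R : R).

Lemma avg_transverse_le (k : W -> R) (c : R) : 0 <= c -> (forall w, k w <= 1) ->
  (forall w : W, w 0 1 != 0 -> k w <= c) -> avg k <= c + q^-1.
Proof.
move=> c_ge0 k_le1 k_lec.
have <- : \pr_(w : W) (w 0 1 == 0) = q^-1 :> R.
  rewrite avg_row2; under eq_avg do under eq_avg do rewrite row2_1.
  by rewrite (avg_const 0) pr_pred1.
rewrite -[X in X + _](avg_const (0 : W)) -avgD; apply: ler_avg => w.
have [_|w1] := eqVneq (w 0 1) 0; last by rewrite addr0 k_lec.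
by rewrite (le_trans (k_le1 w)) // lerDr.
Qed.

Lemma avg_transverse_lines (G : W -> R) (w : W) : w 0 1 != 0 ->
  avg G = \avg_(s : F) \avg_(t : F) G (row2 s 0 + t *: w).
Proof.
move=> w1; rewrite avg_pair.
apply: (avg_bij (h := fun p : F * F => row2 p.1 0 + p.2 *: w)).
exists (fun y : W => (y 0 0 - y 0 1 / w 0 1 * w 0 0, y 0 1 / w 0 1)) => [[s t]|y] /=.
  by rewrite !mxE /= add0r mulfK // addrK.
by apply: eq_row2; rewrite !mxE /=; field.
Qed.

End TransverseDirections.

Section TotalTest.
Variables (R : archiRealFieldType) (F : finFieldType) (m d : nat).
Local Notation V := 'rV[F]_m.
Local Notation W := 'rV[F]_2.
Local Notation q := (#|F|%:R : R).

Section LocalCorrection.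
Variables (g : V -> F) (B : V -> V -> {poly F}).
Hypothesis d_gt0 : (0 < d)%N.
Hypothesis famB : lines_family d B.
Hypothesis fitB : best_fit R d (fun x z => g x != z) B.
Hypothesis small_d : 72 * 1000 * d%:R <= q.
Implicit Types (x u v : V).

Let del := rejection R predT g B + q^-1.

Let invq_le_del : q^-1 <= del.
Proof. by rewrite /del lerDr rejection_ge0. Qed.

Let line_error x u : R := \pr_(t : F) (g (x + t *: u) != (B x u).[t]).

Let plane_rejection x u v : R :=
  rejection R predT (g \o plane_point x u v) (plane_family x u v B).

Lemma avg_plane_rejection_le x :
  \avg_(u : V) \avg_(v : V) plane_rejection x u v <= del + q^-1.
Proof. by have := rejection_plane_le R predT g B x; rewrite /del; lra. Qed.

Lemma best_fit_on_plane x u v : exists2 h : W -> F, polyfun d h & forall y0 : W,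
  \avg_(w : W) line_error (plane_point x u v y0) (lincomb2 u v w) <=
    402 * (plane_rejection x u v + q^-1) /\
  \pr_(w : W) ((B (plane_point x u v y0) (lincomb2 u v w)).[0] != h y0) <=
    1608 * (plane_rejection x u v + q^-1).
Proof.
have [h poly_h fit_h] := plane_best_fit d_gt0 (lines_family_plane x u v famB) small_d
  (best_fit_plane x u v fitB).
exists h => // y0; have [error value] := fit_h y0; split=> //.
by rewrite /line_error; under eq_avg do under eq_avg do rewrite -plane_point_line.
Qed.

Lemma avg_line_error_le x : \avg_(u : V) line_error x u <= 1300 * del.
Proof.
have := avg_le_planes (fun a (_ : V) => pr_in01 R
  (fun t : F => g (x + t *: a) != (B x a).[t])).
under eq_avg do rewrite (avg_const 0).
move=> /le_trans; apply.
apply: (@le_trans _ _ (402 * (del + 2 * q^-1) + 2 / q)).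
  rewrite lerD2r; apply: (@le_trans _ _ (\avg_(u : V) \avg_(v : V)
      (402 * (plane_rejection x u v + q^-1)))).
    apply: ler_avg => u; apply: ler_avg => v;
      have [h _ /(_ 0)[error _]] := best_fit_on_plane x u v.
    by rewrite plane_point0 in error; under eq_avg do rewrite (avg_const 0).
  under eq_avg do rewrite avgZ avgD (avg_const 0).
  by rewrite avgZ avgD (avg_const 0); have := avg_plane_rejection_le x; lra.
by have := invq_gt0 R F; have := invq_le_del; lra.
Qed.

Lemma directions_agree x :
  \avg_(a : V) \pr_(c : V) ((B x c).[0] != (B x a).[0]) <= 100 * 100 * del.
Proof.
apply: le_trans (avg_le_planes (fun a c =>
  indicator_in01 R ((B x c).[0] != (B x a).[0]))) _.
apply: (@le_trans _ _ (3216 * (del + 2 * q^-1) + 2 / q)); last first.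
  by have := invq_gt0 R F; have := invq_le_del; lra.
rewrite lerD2r; apply: (@le_trans _ _ (\avg_(u : V) \avg_(v : V)
    (3216 * (plane_rejection x u v + q^-1)))).
  apply: ler_avg => u; apply: ler_avg => v;
    have [h _ /(_ 0)[_ value]] := best_fit_on_plane x u v.
  rewrite plane_point0 in value.
  apply: (@le_trans _ _ (\avg_(w : W) (\pr_(w' : W) ((B x (lincomb2 u v w')).[0] != h 0) +
      ((B x (lincomb2 u v w)).[0] != h 0)%:R))).
    apply: ler_avg => w; rewrite -[X in _ + X](avg_const (0 : W)); apply: le_pr_or => w'.
    by have [->|] := eqVneq (B x (lincomb2 u v w')).[0] (h 0); rewrite // eq_sym.
  by rewrite avgD (avg_const 0); lra.
under eq_avg do rewrite avgZ avgD (avg_const 0).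
by rewrite avgZ avgD (avg_const 0); have := avg_plane_rejection_le x; lra.
Qed.

Lemma avg_plane_rejection_through_line_le x u :
  \avg_(v : V) plane_rejection x u v <= 1301 * del.
Proof.
apply: (@le_trans _ _ (1300 * del + q^-1)); last by have := invq_le_del; lra.
have -> : \avg_(v : V) plane_rejection x u v =
    \avg_(w : W) \avg_(v : V) \avg_(y : W)
      (g (plane_point x u v y) != (B (plane_point x u v y) (lincomb2 u v w)).[0])%:R.
  exact: avgCA.
apply: avg_transverse_le => [|w|w w1].
- by have := invq_gt0 R F; have := invq_le_del; lra.
- by apply: (avg_le 0) => v; exact: pr_le1.
under eq_avg do rewrite (avg_transverse_lines _ w1).
rewrite avgC; apply: (avg_le 0) => s; apply: le_trans (avg_line_error_le (x + s *: u)).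
rewrite -(avg_lincomb2_transverse (line_error (x + s *: u)) u w1); apply: ler_avg => v.
apply: le_pr => t; rewrite plane_point_line plane_point_axis.
by rewrite (lines_family_shift _ _ _ famB).
Qed.

Lemma plurality_polynomial_on_lines (g' : V -> F) x u :
  10 ^+ 8 * del <= 1 ->
  (forall y, \pr_(a : V) ((B y a).[0] != g' y) <= 100 * 100 * del) ->
  exists2 p : {poly F}, (size p <= d.+1)%N & forall s, g' (x + s *: u) = p.[s].
Proof.
move=> small_del near_g'; have qV_gt0 := invq_gt0 R F; have del_ge := invq_le_del.
have /choice[h fit_h] : forall v, exists h : W -> F, polyfun d h /\ forall y0 : W,
    \pr_(w : W) ((B (plane_point x u v y0) (lincomb2 u v w)).[0] != h y0) <=
      1608 * (plane_rejection x u v + q^-1).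
  move=> v; have [h poly_h fit_h] := best_fit_on_plane x u v.
  by exists h; split=> // y0; case: (fit_h y0).
have /choice[p axis_p] : forall v, exists p : {poly F}, (size p <= d.+1)%N /\
    forall s, h v (row2 s 0) = p.[s].
  move=> v; have [p size_p hp] := polyfun_line 0 (row2 1 0) (fit_h v).1.
  exists p; split => // s; rewrite -hp add0r; congr h.
  by apply: eq_row2; rewrite !mxE /= ?mulr1 ?mulr0.
apply: (majority_poly (0 : V) (p := p) (del := 1 / 10 : R)) => [v|s|].
- by case: (axis_p v).
- have near_plane : \avg_(v : V) \pr_(w : W)
      ((B (x + s *: u) (lincomb2 u v w)).[0] != g' (x + s *: u)) <=
      100 * 100 * del + q^-1 :> R.
    rewrite avgC; apply: avg_transverse_le => [|w|w w1]; first by lra.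
      exact: pr_le1.
    rewrite (avg_lincomb2_transverse (fun a =>
      ((B (x + s *: u) a).[0] != g' (x + s *: u))%:R) u w1).
    exact: near_g'.
  apply: (@le_trans _ _ (\avg_(v : V) (1608 * (plane_rejection x u v + q^-1) +
      \pr_(w : W) ((B (x + s *: u) (lincomb2 u v w)).[0] != g' (x + s *: u))))).
    apply: ler_avg => v; rewrite -(axis_p v).2 -[leLHS](avg_const (0 : W)).
    have := (fit_h v).2 (row2 s 0); rewrite plane_point_axis => fit_v.
    apply: le_trans (lerD fit_v (lexx _)); apply: le_pr_or => w.
    by have [->|] := eqVneq (h v (row2 s 0)) (B (x + s *: u) (lincomb2 u v w)).[0].
  rewrite avgD avgZ avgD (avg_const 0).
  by have := avg_plane_rejection_through_line_le x u; lra.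
- by have := ratio_card_field_le _ small_d; lra.
Qed.

Lemma best_fit_correction : 10 ^+ 8 * del <= 1 ->
  exists2 g' : V -> F, polyfun d g' & \pr_(x : V) (g x != g' x) <= 100 * 101 * del.
Proof.
move=> small_del.
have /choice[g' near_g'] : forall x, exists z : F,
    \pr_(u : V) ((B x u).[0] != z) <= 100 * 100 * del.
  move=> x; have [z le_z] := pr_neq_plurality R (0 : V) (fun u => (B x u).[0]).
  by exists z; apply: le_trans le_z (directions_agree x).
exists g'.
  apply: polyfun_of_lines => [|x u]; last exact: plurality_polynomial_on_lines.
  rewrite -(ltr_nat R) natrM; have : (1 : R) <= d%:R by rewrite ler1n.
  by move: small_d; lra.
apply: (@le_trans _ _ (rejection R predT g B +
    \avg_(x : V) \pr_(u : V) ((B x u).[0] != g' x))).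
  rewrite -avgD; apply: ler_avg => x; rewrite -[leLHS](avg_const (0 : V)).
  by apply: le_pr_or => u; have [->|] := eqVneq (g x) (B x u).[0].
have : \avg_(x : V) \pr_(u : V) ((B x u).[0] != g' x) <= 100 * 100 * del.
  by apply: (avg_le 0) => x; exact: near_g'.
by have := invq_gt0 R F; have := invq_le_del; rewrite /del; lra.
Qed.

End LocalCorrection.

Theorem total_test (g : V -> F) (H : V -> V -> {poly F})
    (del := rejection R predT g H + q^-1) :
  (0 < d)%N -> lines_family d H -> 72 * 1000 * d%:R <= q -> 10 ^+ 8 * del <= 1 ->
  exists2 Q : V -> F, polyfun d Q & \pr_(x : V) (g x != Q x) <= 1 / 100 :> R.
Proof.
move=> d_gt0 famH small_d small_del.
have [B famB fitB] := best_fit_exists R (fun x z => g x != z) d.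
have rejB : rejection R predT g B <= rejection R predT g H.
  rewrite (rejection_lines _ _ _ famB) (rejection_lines _ _ _ famH).
  by apply: ler_avg => x; apply: ler_avg => u; exact: fitB (famH.1 x u).
have le_del : rejection R predT g B + q^-1 <= del by rewrite lerD2r.
have [|Q poly_Q near_Q] := best_fit_correction d_gt0 famB fitB small_d.
  by apply: le_trans small_del; rewrite ler_pM2l ?exprn_gt0.
by exists Q => //; apply: le_trans near_Q _; lra.
Qed.

End TotalTest.

Section PartialTest.
Variables (R : archiRealFieldType) (F : finFieldType) (m d : nat).
Local Notation V := 'rV[F]_m.
Local Notation W := 'rV[F]_2.
Local Notation q := (#|F|%:R : R).

Definition inconsistency k (H : 'rV[F]_k -> 'rV[F]_k -> {poly F}) : R :=
  \avg_(x : 'rV[F]_k) \avg_(a : 'rV[F]_k) \pr_(c : 'rV[F]_k) ((H x c).[0] != (H x a).[0]).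

Lemma inconsistency_plane_le (H : V -> V -> {poly F}) :
  inconsistency H <=
    \avg_(x : V) \avg_(u : V) \avg_(v : V) inconsistency (plane_family x u v H) + 2 / q.
Proof.
pose G a c : R := \pr_(x : V) ((H x c).[0] != (H x a).[0]).
have -> : inconsistency H = \avg_(a : V) \avg_(c : V) G a c.
  by rewrite /inconsistency -avgCA.
apply: le_trans (avg_le_planes (fun a c =>
  pr_in01 R (fun x => (H x c).[0] != (H x a).[0]))) _.
rewrite lerD2r -[leRHS]avgCA.
apply: ler_avg => u; apply: ler_avg => v; rewrite [leRHS]avgC; apply: (avg_ge 0) => y.
rewrite (avg_addr (fun x => \avg_(w : W) \pr_(w' : W)
  ((H x (lincomb2 u v w')).[0] != (H x (lincomb2 u v w)).[0]))).
by rewrite avgCA.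
Qed.

Lemma polyfun_of_consistent (H : V -> V -> {poly F}) :
  (0 < d)%N -> lines_family d H -> 10 ^+ 7 * d%:R <= q -> 10 ^+ 13 * q^-1 <= 1 ->
  inconsistency H <= 200 * 200 / 10 ^+ 13 ->
  exists2 Q : V -> F, polyfun d Q &
    \avg_(x : V) \pr_(u : V) [exists t, (H x u).[t] != Q (x + t *: u)] <= 1 / 10 :> R.
Proof.
move=> d_gt0 famH small_d small_qV small_inc.
have d_ge1 : (1 : R) <= d%:R by rewrite ler1n.
have /choice[g near_g] : forall x, exists z : F, \pr_(u : V) ((H x u).[0] != z) <=
    \avg_(a : V) \pr_(c : V) ((H x c).[0] != (H x a).[0]) :> R.
  by move=> x; exact: pr_neq_plurality.
have rej_g : rejection R predT g H <= 200 * 200 / 10 ^+ 13.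
  apply: le_trans small_inc; apply: ler_avg => x; apply: le_trans (near_g x).
  by apply: le_pr => u; rewrite eq_sym.
have [||Q poly_Q near_Q] := @total_test R F m d g H d_gt0 famH; [by lra|by lra|].
exists Q => //; have rej_Q : rejection R predT Q H <= 1 / 100 + 200 * 200 / 10 ^+ 13.
  apply: le_trans (lerD near_Q rej_g); rewrite -avgD; apply: ler_avg => x.
  rewrite -[X in X + _](avg_const (0 : V)); apply: le_pr_or => u.
  by rewrite [g x == Q x]eq_sym; have [->|] := eqVneq (Q x) (g x).
have := @line_rigidity R F m d predT Q H poly_Q famH;
  rewrite (avg_const 0) mul1r => rigid.
by apply: le_trans (rigid ltr01 _) _; lra.
Qed.

Section PartialFunction.
Variables (D : pred V) (f : V -> F) (H : V -> V -> {poly F}).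
Local Notation dens := (\pr_(x : V) D x : R).
Local Notation rej := (rejection R D f H).
Hypothesis d_gt0 : (0 < d)%N.
Hypothesis famH : lines_family d H.
Hypothesis dens_gt0 : 0 < dens.

Lemma pr_sparse_plane_le :
  \avg_(x : V) \avg_(u : V)
    \pr_(v : V) (\pr_(y : W) D (plane_point x u v y) < dens / 4) <= 8 / (dens * q).
Proof.
pose sparse x u := line_density R D x u < dens / 2.
apply: (@le_trans _ _ (\avg_(x : V) \avg_(u : V) \avg_(v : V)
   (2 * \pr_(s : F) sparse (x + s *: v) u))).
  apply: ler_avg => x; apply: ler_avg => u; apply: ler_avg => v.
  set c := \pr_(s : F) _; have c_ge0 : 0 <= c := pr_ge0 _ _.
  case: ltP => [sparse_plane|_] /=; last by rewrite mulr_ge0.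
  have : dens / 2 * (1 - c) < dens / 4; last by rewrite -mulrA ltr_pM2l //; lra.
  apply: le_lt_trans sparse_plane.
  rewrite avg_row2 avgC -(pr_not R (0 : F)) -avgZ; apply: ler_avg => s.
  have -> : \avg_(t : F) (D (plane_point x u v (row2 t s)))%:R =
      line_density R D (x + s *: v) u.
    by apply: eq_avg => t; rewrite /plane_point lincomb2_row2 addrCA addrC.
  rewrite /sparse; case: ltP => [_|dense] /=; last by rewrite mulr1.
  by rewrite mulr0; exact: pr_ge0.
under eq_avg do under eq_avg do rewrite avgZ.
under eq_avg do rewrite avgZ.
rewrite avgZ.
have -> : \avg_(x : V) \avg_(u : V) \avg_(v : V) \pr_(s : F) sparse (x + s *: v) u =
    \avg_(x : V) \pr_(u : V) sparse x u :> R.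
  rewrite [LHS]avgC [RHS]avgC; apply: eq_avg => u.
  rewrite (avg_line_shift (fun x _ => (sparse x u)%:R)).
  by apply: eq_avg => x; rewrite (avg_const 0).
by have := line_sampling dens_gt0; rewrite -/sparse; lra.
Qed.

Hypothesis small_d : 10 ^+ 7 * d%:R <= dens ^+ 3 * q.

Let dens_le1 : dens <= 1 := pr_le1 _ _.

Let dens2_le1 : dens ^+ 2 <= 1.
Proof. by rewrite exprn_ile1 // ltW. Qed.

Lemma plane_inconsistency_le x u v
    (plane_rej := rejection R (D \o plane_point x u v) (f \o plane_point x u v)
      (plane_family x u v H)) :
  inconsistency (plane_family x u v H) <=
    (\pr_(y : W) D (plane_point x u v y) < dens / 4)%R%:R +
    160 * 80 / dens ^+ 2 * (q^-1 + plane_rej).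
Proof.
have plane_rej_ge0 : 0 <= plane_rej := rejection_ge0 _ _ _ _; have qV_gt0 := invq_gt0 R F.
have inc_le1 : inconsistency (plane_family x u v H) <= 1.
  by do 2![apply: (avg_le 0) => ?]; exact: pr_le1.
have dens2_gt0 : 0 < dens ^+ 2 by rewrite exprn_gt0.
set bound := 160 * 80 / _ * _; have bound_ge0 : 0 <= bound.
  apply: mulr_ge0 (addr_ge0 (ltW qV_gt0) plane_rej_ge0).
  by apply: divr_ge0 (ltW dens2_gt0); lra.
case: ltP => [_|denseD] /=; first by apply: (le_trans inc_le1); rewrite lerDl.
rewrite add0r; have [small_rej|large_rej] := leP plane_rej (dens / 4 / 2); last first.
  apply: (le_trans inc_le1); rewrite /bound mulrAC ler_pdivlMr // mul1r.
  have : dens ^+ 2 <= dens by rewrite expr2 ger_pMl.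
  by lra.
have [|||h poly_h rigid] := partial_plane_rigidity d_gt0 (lines_family_plane x u v famH)
    _ _ _ denseD small_rej.
- by rewrite divr_gt0.
- by have := dens_le1; lra.
- have -> : (dens / 4) ^+ 3 * q = dens ^+ 3 * q / 64 by field.
  by have := small_d; have := ler0n R d; lra.
pose bad y w := [exists t, (plane_family x u v H y w).[t] != h (y + t *: w)].
have -> : bound = 2 * (400 * (q^-1 + plane_rej) / (dens / 4) ^+ 2).
  by rewrite /bound; field; rewrite !gt_eqF ?card_field_gt0.
apply: (@le_trans _ _ (2 * \avg_(y : W) \pr_(w : W) bad y w)); last by rewrite ler_pM2l.
rewrite -avgZ; apply: ler_avg => y.
apply: (@le_trans _ _ (\avg_(w : W) (\pr_(w' : W) bad y w' + (bad y w)%:R))).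
  apply: ler_avg => w; rewrite -[X in _ + X](avg_const (0 : W)); apply: le_pr_or => w'.
  apply: contraR; rewrite negb_or => /andP[/existsPn/(_ 0) + /existsPn/(_ 0)].
  by rewrite !negbK !scale0r !addr0 => /eqP -> /eqP ->.
by rewrite avgD (avg_const 0); lra.
Qed.

Lemma inconsistency_le : inconsistency H <= 200 * 200 * (rej + q^-1) / dens ^+ 2.
Proof.
have rej_ge0 : 0 <= rej := rejection_ge0 _ _ _ _; have qV_gt0 := invq_gt0 R F.
have dens2_gt0 : 0 < dens ^+ 2 by rewrite exprn_gt0.
set K := 160 * 80 / dens ^+ 2.
have K_ge0 : 0 <= K by apply: divr_ge0 (ltW dens2_gt0); lra.
have planes :
    \avg_(x : V) \avg_(u : V) \avg_(v : V) inconsistency (plane_family x u v H) <=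
    8 / (dens * q) + K * (q^-1 + (rej + 2 / q)).
  apply: le_trans
    (ler_avg (fun x => ler_avg (fun u => ler_avg (plane_inconsistency_le x u)))) _.
  under eq_avg do under eq_avg do rewrite avgD avgZ avgD (avg_const 0).
  under eq_avg do rewrite avgD avgZ avgD (avg_const 0).
  rewrite avgD avgZ avgD (avg_const 0) lerD ?pr_sparse_plane_le //.
  rewrite ler_wpM2l // lerD2l; apply: (avg_le 0) => x; exact: rejection_plane_le.
apply: (le_trans (inconsistency_plane_le H)); apply: (le_trans (lerD planes (lexx _))).
rewrite ler_pdivlMr // /K.
have -> : (8 / (dens * q) + 160 * 80 / dens ^+ 2 * (q^-1 + (rej + 2 / q)) + 2 / q) *
    dens ^+ 2 =
    8 * (dens * q^-1) + 160 * 80 * (q^-1 + (rej + 2 / q)) + 2 * (dens ^+ 2 * q^-1).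
  by field; rewrite !gt_eqF ?card_field_gt0.
have : dens * q^-1 <= q^-1 by rewrite ger_pMl.
have : dens ^+ 2 * q^-1 <= q^-1 by rewrite ger_pMl.
by lra.
Qed.

(* On a line along which H restricts to Q, every point of D where f agrees with
   H is an agreement between f and Q. *)
Lemma agreement_of_rigid_lines (Q : V -> F)
    (beta := \avg_(x : V) \pr_(u : V) [exists t, (H x u).[t] != Q (x + t *: u)]) :
  dens / 2 * (1 - 4 / (dens * q) - beta) - rej <= \pr_(x : V) (D x && (f x == Q x)).
Proof.
pose sparse x u := line_density R D x u < dens / 2.
pose bad x u := [exists t, (H x u).[t] != Q (x + t *: u)].
pose err x u : R := \pr_(t : F) (D (x + t *: u) && (f (x + t *: u) != (H x u).[t])).
pose good x u : R := \pr_(t : F) (D (x + t *: u) && (f (x + t *: u) == Q (x + t *: u))).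
have line_bound x u :
    dens / 2 * (1 - (sparse x u)%:R - (bad x u)%:R) - err x u <= good x u.
  have err_ge0 : 0 <= err x u := pr_ge0 _ _; have good_ge0 : 0 <= good x u := pr_ge0 _ _.
  have dens_pos := dens_gt0; rewrite /sparse /bad.
  case: ltP => [_|dense]; first by case: existsP => _ /=; lra.
  case: existsP => [_|no_bad] /=; first by lra.
  apply: (@le_trans _ _ (line_density R D x u - err x u)); first by lra.
  rewrite lerBlDr; apply: le_pr_or => t Dt; rewrite Dt /=.
  have -> : (H x u).[t] = Q (x + t *: u).
    by apply/eqP; apply: contraPT isT => neq; case: no_bad; exists t.
  exact: orbN.
have -> : \pr_(x : V) (D x && (f x == Q x)) = \avg_(x : V) \avg_(u : V) good x u.
  rewrite (avg_line_shift (fun x _ => (D x && (f x == Q x))%:R)).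
  by apply: eq_avg => x; rewrite (avg_const 0).
apply: le_trans (ler_avg (fun x => ler_avg (line_bound x))).
under eq_avg do rewrite avgB avgZ !avgB (avg_const 0).
rewrite avgB avgZ !avgB (avg_const 0) (rejection_lines _ _ _ famH) lerD2r.
rewrite ler_pM2l ?divr_gt0 //; apply: lerB => //; rewrite lerD2l lerN2.
exact: line_sampling.
Qed.

Theorem partial_test : 10 ^+ 13 * (rej + q^-1) <= dens ^+ 2 ->
  exists2 Q : V -> F, polyfun d Q & dens / 20 <= \pr_(x : V) (D x && (f x == Q x)).
Proof.
move=> small_rej; have q_gt0 := card_field_gt0 R F; have qV_gt0 := invq_gt0 R F.
have rej_ge0 : 0 <= rej := rejection_ge0 _ _ _ _; have dens_pos := dens_gt0.
have dens2_le : dens ^+ 2 <= dens by rewrite expr2 ger_pMl.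
have d_le_q : 10 ^+ 7 * d%:R <= q.
  by apply: (le_trans small_d); rewrite ger_pMl // exprn_ile1 // ltW.
have qV_le : 10 ^+ 13 * q^-1 <= dens ^+ 2.
  by apply: le_trans small_rej; rewrite ler_pM2l ?exprn_gt0 // lerDr.
have rej_le : 10 ^+ 13 * rej <= dens ^+ 2.
  by apply: le_trans small_rej; rewrite ler_pM2l ?exprn_gt0 // lerDl ltW.
have small_inc : inconsistency H <= 200 * 200 / 10 ^+ 13.
  apply: le_trans inconsistency_le _; rewrite ler_pdivrMr ?exprn_gt0 // -[leRHS]mulrA.
  by rewrite ler_pM2l ?mulr_gt0 // ler_pdivlMl ?exprn_gt0.
have [Q poly_Q rigid] :=
  polyfun_of_consistent d_gt0 famH d_le_q (le_trans qV_le dens2_le1) small_inc.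
exists Q => //; apply: le_trans (agreement_of_rigid_lines Q).
have sampling_le : 4 / (dens * q) <= 1 / 100.
  by rewrite invfM mulrCA ler_pdivrMl //; lra.
apply: (@le_trans _ _ (dens / 2 * (1 - 1 / 100 - 1 / 10) - rej)); first by lra.
by rewrite lerD2r ler_wpM2l ?divr_ge0 ?(ltW dens_gt0) //; lra.
Qed.

End PartialFunction.
End PartialTest.

(** * Decoding around a base point *)

Section ListDecoding.
Variables (R : realFieldType) (F : finFieldType) (m d : nat).
Local Notation V := 'rV[F]_m.
Local Notation q := (#|F|%:R : R).
Implicit Types (f : V -> F) (k : {ffun V -> F}).

Definition close_polys f (del : R) : {set {ffun V -> F}} :=
  [set k : {ffun V -> F} | `[< polyfun d k >] & del <= \pr_(y : V) (f y == k y)].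

Lemma close_polysP f del k :
  reflect (polyfun d k /\ del <= \pr_(y : V) (f y == k y)) (k \in close_polys f del).
Proof. by rewrite inE; apply: (iffP andP) => -[/asboolP]. Qed.

Lemma close_polys_agreement_le f del k k' :
  k \in close_polys f del -> k' \in close_polys f del -> k != k' ->
  \pr_(y : V) (k y == k' y) <= (d.+1)%:R / q.
Proof.
move=> /close_polysP[poly_k _] /close_polysP[poly_k' _] neq_k.
have [z neq_z] : exists z, k z != k' z.
  apply: contrapT => no_z; case/eqP: neq_k; apply/ffunP => z.
  by apply/eqP; apply: contraPT isT => neq_z; case: no_z; exists z.
exact: pr_polyfun_eq_le neq_z.
Qed.

Lemma card_close_polys f del : 0 < del -> 2 * ((d.+1)%:R / q) < del ^+ 2 ->
  #|close_polys f del|%:R <= 2 / del.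
Proof.
move=> del_gt0 small_d.
apply: (card_almost_disjoint_le (A := fun k y => f y == k y) (0 : V) del_gt0 _ small_d).
- by rewrite divr_ge0 ?ler0n.
- by move=> k /close_polysP[].
- move=> k k' kL k'L neq_k; apply: le_trans (close_polys_agreement_le kL k'L neq_k).
  by apply: le_pr => y /andP[/eqP -> ].
Qed.

Definition collides (L : {set {ffun V -> F}}) (x : V) : bool :=
  [exists k in L, exists k' in L, (k != k') && (k x == k' x)].

Lemma pr_collides_le f del : 0 < del -> 2 * ((d.+1)%:R / q) < del ^+ 2 ->
  \pr_(x : V) collides (close_polys f del) x <= (2 / del) ^+ 2 * ((d.+1)%:R / q).
Proof.
move=> del_gt0 small_d; set L := close_polys f del.
have ratio_ge0 : 0 <= (d.+1)%:R / q by rewrite divr_ge0 ?ler0n.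
apply: (@le_trans _ _ (\sum_(k in L) \sum_(k' in L) (d.+1)%:R / q)).
  apply: le_trans (pr_exists_in _ _ _) _; apply: ler_sum => k kL.
  apply: le_trans (pr_exists_in _ _ _) _; apply: ler_sum => k' k'L.
  have [->|neq_k] := eqVneq k k'; first by rewrite (avg_const 0).
  exact: close_polys_agreement_le kL k'L neq_k.
rewrite !sumr_const -mulrnA -[leLHS]mulr_natl natrM -expr2.
rewrite ler_wpM2r // lerXn2r ?nnegrE ?ler0n ?divr_ge0 ?(ltW del_gt0) //.
exact: card_close_polys.
Qed.

End ListDecoding.

Section PlaneLists.
Variables (R : archiRealFieldType) (F : finFieldType).
Local Notation W := 'rV[F]_2.
Local Notation q := (#|F|%:R : R).

Lemma pr_outside_close_polys_le d (f : W -> F) (P : W -> W -> {poly F}) (eps : R) :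
  (0 < d)%N -> 0 < eps -> eps <= 1 -> 72 * d%:R <= eps ^+ 3 * q -> lines_family d P ->
  \avg_(x : W) \pr_(u : W) ((f x == (P x u).[0]) &&
    [forall k in close_polys d f (eps ^+ 2), exists t, (P x u).[t] != k (x + t *: u)])
  <= 5 * eps.
Proof.
move=> d_gt0 eps_gt0 eps_le1 small_d famP; rewrite leNgt; apply/negP => /ltW accept.
pose E x u := (f x == (P x u).[0]) &&
  [forall k in close_polys d f (eps ^+ 2), exists t, (P x u).[t] != k (x + t *: u)].
have fE x u : E x u -> f x = (P x u).[0] by case/andP=> /eqP.
have [k [poly_k [x [u [Exu eq_k]]] agree]] :=
  plane_test d_gt0 eps_gt0 eps_le1 small_d famP fE accept.
have kL : finfun k \in close_polys d f (eps ^+ 2).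
  apply/close_polysP; split; first by apply: eq_polyfun poly_k => y; rewrite ffunE.
  by apply: (le_trans agree); apply: le_pr => y; rewrite ffunE => /andP[].
have /andP[_ /forall_inP/(_ _ kL)/existsP[t]] := Exu.
by rewrite ffunE eq_k eqxx.
Qed.

Lemma pr_collides_close_polys_le d (f : W -> F) (eps : R) :
  (0 < d)%N -> 0 < eps -> eps <= 1 -> 72 * d%:R <= eps ^+ 5 * q ->
  \pr_(x : W) collides (close_polys d f (eps ^+ 2)) x <= eps.
Proof.
move=> d_gt0 eps_gt0 eps_le1 small_d; have q_gt0 := card_field_gt0 R F.
have ratio_le : (d.+1)%:R / q <= eps ^+ 5 / 36.
  rewrite ler_pdivrMr // -natr1; have : (1 : R) <= d%:R by rewrite ler1n.
  by lra.
have eps4_gt0 : 0 < eps ^+ 4 by rewrite exprn_gt0.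
have small_ratio : 2 * ((d.+1)%:R / q) < (eps ^+ 2) ^+ 2.
  rewrite -exprM; have : eps ^+ 5 <= eps ^+ 4 by rewrite exprS ger_pMl.
  by lra.
apply: le_trans (pr_collides_le f (exprn_gt0 2 eps_gt0) small_ratio) _.
apply: (@le_trans _ _ ((2 / eps ^+ 2) ^+ 2 * (eps ^+ 5 / 36))).
  by rewrite ler_wpM2l ?sqr_ge0.
by have -> : (2 / eps ^+ 2) ^+ 2 * (eps ^+ 5 / 36) = eps / 9; [field;
  rewrite gt_eqF | lra].
Qed.

Lemma plane_decoding d (f : W -> F) (P : W -> W -> {poly F}) (eps : R) :
  (0 < d)%N -> 0 < eps -> eps <= 1 -> 72 * d%:R <= eps ^+ 5 * q -> lines_family d P ->
  exists2 h : W -> W -> F, (forall x, polyfun d (h x)) &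
    \avg_(x : W) \pr_(u : W) ((f x == (P x u).[0]) &&
      [exists t, (P x u).[t] != h x (x + t *: u)]) <= 6 * eps.
Proof.
move=> d_gt0 eps_gt0 eps_le1 small_d famP; have q_gt0 := card_field_gt0 R F.
have small_d3 : 72 * d%:R <= eps ^+ 3 * q.
  apply: (le_trans small_d); rewrite ler_pM2r // (exprD eps 3 2) ger_pMr ?exprn_gt0 //.
  by rewrite exprn_ile1 // ltW.
set L := close_polys d f (eps ^+ 2).
have collision_le := pr_collides_close_polys_le f d_gt0 eps_gt0 eps_le1 small_d.
have outside_le := pr_outside_close_polys_le f d_gt0 eps_gt0 eps_le1 small_d3 famP.
pose h x : W -> F := if [pick k in L | k x == f x] is Some k then k else fun=> 0.
exists h => [x|].
  rewrite /h; case: pickP => [k /andP[/close_polysP[] //]|_]; exact: polyfun_const.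
apply: (@le_trans _ _ (\avg_(x : W) (\pr_(u : W) ((f x == (P x u).[0]) &&
    [forall k in L, exists t, (P x u).[t] != k (x + t *: u)]) +
    (collides L x)%:R))); last first.
  by rewrite avgD; lra.
apply: ler_avg => x; rewrite -[X in _ + X](avg_const (0 : W)).
apply: le_pr_or => u /andP[fx /existsP[t neq_h]]; rewrite fx /=.
case: forall_inP => //= in_list.
have [k kL eq_k] : exists2 k, k \in L & forall t, (P x u).[t] = k (x + t *: u).
  apply: contrapT => no_k; apply: in_list => k kL; apply: contraPT isT => /existsPn eq_k.
  by case: no_k; exists k => // s; apply/eqP; rewrite -[_ == _]negbK.
have kx : k x = f x by rewrite (eqP fx) eq_k scale0r addr0.
move: neq_h; rewrite /h; case: pickP => [k' /andP[k'L /eqP k'x] neq_k'|/(_ k)];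
  last first.
  by rewrite kL kx eqxx.
apply/exists_inP; exists k => //; apply/exists_inP; exists k' => //.
by rewrite kx k'x eqxx andbT; apply: contraNneq neq_k' => <-; rewrite eq_k.
Qed.

End PlaneLists.

Section TwoPointAgreement.
Variables (R : realFieldType) (F : finFieldType) (m : nat).
Local Notation V := 'rV[F]_m.
Local Notation q := (#|F|%:R : R).
Implicit Types (f : V -> F) (P : V -> V -> {poly F}).

Definition acceptance f P : R := \avg_(x : V) \pr_(u : V) (f x == (P x u).[0]).

Lemma acceptance_sqr_le_pairs d f P (K : R) : lines_family d P -> 0 <= K ->
  (forall s : F, s != 0 -> \avg_(x : V) \pr_(u : V)
     ((f x == (P x u).[0]) && (f (x + s *: u) == (P x u).[s])) <= K) ->
  acceptance f P ^+ 2 <= K + q^-1.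
Proof.
move=> famP K_ge0 pair_le; rewrite /acceptance.
pose hit x u t := f (x + t *: u) == (P x u).[t].
have -> : \avg_(x : V) \pr_(u : V) (f x == (P x u).[0]) =
    \avg_(p : V * V) \pr_(t : F) hit p.1 p.2 t :> R.
  rewrite -(avg_line_shift (fun x u => (f x == (P x u).[0])%:R)) avg_pair.
  by apply: eq_avg => p; apply: eq_avg => t; rewrite (lines_family_shift _ _ _ famP).
apply: (le_trans (avg_sqr_le (0, 0) _)).
have -> : \avg_(p : V * V) (\pr_(t : F) hit p.1 p.2 t) ^+ 2 =
    \avg_(t : F) \avg_(t' : F) \avg_(x : V) \pr_(u : V) (hit x u t && hit x u t') :> R.
  rewrite avgACA avg_pair; apply: eq_avg => p; rewrite expr2 avgM.
  by apply: eq_avg => t; apply: eq_avg => t'; rewrite -natrM mulnb.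
apply: (avg_le 0) => t.
apply: (@le_trans _ _ (\avg_(t' : F) (K + (t' == t)%:R))); last first.
  by rewrite avgD (avg_const 0) pr_pred1.
apply: ler_avg => t'; have [_|tt'] := eqVneq t' t.
  apply: (@le_trans _ _ 1); last by rewrite lerDr.
  by apply: (avg_le 0) => x; exact: pr_le1.
rewrite addr0; apply: le_trans (pair_le (t' - t) _); last by rewrite subr_eq0.
rewrite avgC [leRHS]avgC; apply: ler_avg => u.
rewrite -[leRHS](avg_addr _ (t *: u)); apply: le_pr => x; rewrite /hit.
have [_ shiftP] := famP.
by rewrite !shiftP addr0 -addrA -scalerDl subrKC.
Qed.

Lemma acceptance_sqr_ge f P (eps : R) : 0 < eps -> 5 * eps <= acceptance f P ->
  25 * eps ^+ 2 <= acceptance f P ^+ 2.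
Proof.
move=> eps_gt0 accept; have eps5_ge0 : 0 <= 5 * eps by rewrite mulr_ge0 // ltW.
rewrite (_ : 25 * eps ^+ 2 = (5 * eps) ^+ 2); last by ring.
by rewrite lerXn2r ?nnegrE ?(le_trans eps5_ge0 accept).
Qed.

Lemma constant_test f P (eps : R) : lines_family 0 P ->
  0 < eps -> 5 * eps <= acceptance f P ->
  exists2 Q : V -> F, polyfun 0 Q & eps ^+ 2 <= \pr_(x : V) (f x == Q x).
Proof.
move=> famP eps_gt0 accept; pose K : R := \avg_(x : V) \pr_(y : V) (f y == f x).
have K_ge0 : 0 <= K by apply: avg_ge0 => x; exact: pr_ge0.
have collision : acceptance f P ^+ 2 <= K + q^-1.
  apply: (acceptance_sqr_le_pairs famP K_ge0) => s s0.
  rewrite /K -(avg_line_points (fun x y => (f y == f x)%:R) (t := 0) (t' := s)) //;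
    last by rewrite eq_sym.
  apply: ler_avg => x; apply: le_pr => u /andP[/eqP fx /eqP fxs].
  by rewrite scale0r addr0 fx fxs (size1_polyC (famP.1 x u)) !hornerC.
have accept2 : 25 * eps ^+ 2 <= K + q^-1.
  exact: le_trans (acceptance_sqr_ge eps_gt0 accept) collision.
have eps2_gt0 : 0 < eps ^+ 2 by rewrite exprn_gt0.
have [large_K|small_K] := leP (eps ^+ 2) K.
  have [y K_le] := avg_ex_ge (0 : V) (fun x => \pr_(y : V) (f y == f x) : R).
  by exists (fun=> f y); [exact: polyfun_const | exact: le_trans large_K K_le].
have [c c_ge] := avg_ex_ge (0 : F) (fun c => \pr_(x : V) (f x == c) : R).
exists (fun=> c); first exact: polyfun_const.
apply: le_trans c_ge; rewrite avgC.
under eq_avg do under eq_avg do rewrite eq_sym.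
under eq_avg do rewrite pr_pred1.
by rewrite (avg_const 0); lra.
Qed.

Definition joint_agreement f P x z : bool :=
  (f x == (P x z).[0]) && (f (x + z) == (P x z).[1]).

Lemma acceptance_sqr_le d f P : lines_family d P -> scaling_invariant P ->
  acceptance f P ^+ 2 <= \avg_(x : V) \pr_(z : V) joint_agreement f P x z + q^-1.
Proof.
move=> famP scaleP; apply: (acceptance_sqr_le_pairs famP) => [|s s0].
  by apply: avg_ge0 => x; exact: pr_ge0.
apply: ler_avg => x; rewrite -[leRHS](avg_scale _ s0); apply: le_pr => u.
by rewrite /joint_agreement !scaleP // mulr0 mulr1.
Qed.

End TwoPointAgreement.

Section Cone.
Variables (R : archiRealFieldType) (F : finFieldType) (m d : nat).
Local Notation V := 'rV[F]_m.
Local Notation W := 'rV[F]_2.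
Local Notation q := (#|F|%:R : R).
Variables (f : V -> F) (P : V -> V -> {poly F}).
Hypothesis famP : lines_family d P.

Definition cone_error (k : V -> V -> W -> F) (x : V) : R :=
  \avg_(u : V) \avg_(v : V) \pr_(w : W) ((f x == (P x (lincomb2 u v w)).[0]) &&
    [exists t, (P x (lincomb2 u v w)).[t] != k u v (t *: w)]).

Lemma cone_decoding (e : R) : (0 < d)%N -> 0 < e -> e <= 1 -> 72 * d%:R <= e ^+ 5 * q ->
  exists2 k : V -> V -> V -> W -> F, (forall x u v, polyfun d (k x u v)) &
    \avg_(x : V) cone_error (k x) x <= 6 * e.
Proof.
move=> d_gt0 e_gt0 e_le1 small_d.
pose miss (h : W -> F) a u v y w :=
  (f (plane_point a u v y) == (plane_family a u v P y w).[0]) &&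
  [exists t, (plane_family a u v P y w).[t] != h (y + t *: w)].
have /choice[h decode] : forall auv : V * V * V, exists h : W -> W -> F,
    (forall y, polyfun d (h y)) /\
    \avg_(y : W) \pr_(w : W) miss (h y) auv.1.1 auv.1.2 auv.2 y w <= 6 * e.
  move=> [[a u] v] /=; have [h poly_h miss_le] := plane_decoding (f \o plane_point a u v)
    d_gt0 e_gt0 e_le1 small_d (lines_family_plane a u v famP).
  by exists h.
pose base x u v y : V := x - lincomb2 u v y.
pose avg_miss x u v y : R :=
  \pr_(w : W) miss (h (base x u v y, u, v) y) (base x u v y) u v y w.
have /choice[y0 best_y0] : forall xuv : V * V * V, exists y,
    avg_miss xuv.1.1 xuv.1.2 xuv.2 y <= avg (avg_miss xuv.1.1 xuv.1.2 xuv.2).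
  by move=> xuv; exact: avg_ex_le 0 _.
exists (fun x u v z =>
  let y := y0 (x, u, v) in h (base x u v y, u, v) y (y + z)) => [x u v|].
  by apply: polyfun_translate; exact: (decode (_, u, v)).1.
apply: (@le_trans _ _ (\avg_(x : V) \avg_(u : V) \avg_(v : V) avg (avg_miss x u v))).
  do 3![apply: ler_avg => ?]; apply: le_trans (best_y0 (_, _, _)); apply: le_pr => w.
  by rewrite /miss /plane_family /plane_point /base subrK.
rewrite -avgCA; apply: (avg_le 0) => u; apply: (avg_le 0) => v.
rewrite avgC; under eq_avg => y.
  rewrite -(avg_addr _ (lincomb2 u v y)).
  under eq_avg => x do rewrite /avg_miss /base addrK.
  over.
by rewrite avgC; apply: (avg_le 0) => x; exact: (decode (x, u, v)).2.
Qed.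

Definition cone_domain (x y : V) : bool := joint_agreement f P x (y - x).

Lemma cone_rejection_le (k : V -> V -> W -> F) x (H : V -> V -> {poly F}) :
  (forall u v, polyfun d (k u v)) -> lines_family d H ->
  best_fit R d (fun y z => cone_domain x y && (f y != z)) H ->
  rejection R (cone_domain x) f H <= cone_error k x + 2 / q.
Proof.
set D := cone_domain x => poly_k famH fitH; rewrite (rejection_lines _ _ _ famH).
pose wrong y u : R := \pr_(t : F) (D (y + t *: u) && (f (y + t *: u) != (H y u).[t])).
rewrite -(avg_addl (fun y => \avg_(u : V) wrong y u) x).
apply: le_trans (avg_le_planes (fun a u => pr_in01 R
  (fun t : F => D (x + a + t *: u) && (f (x + a + t *: u) != (H (x + a) u).[t])))) _.
rewrite lerD2r.
apply: ler_avg => u; apply: ler_avg => v.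
pose miss w := D (plane_point x u v w) && (f (plane_point x u v w) != k u v w).
apply: (@le_trans _ _ (\pr_(w : W) miss w)); last first.
  apply: le_pr => w /andP[+ neq_k].
  rewrite /D /cone_domain /plane_point addrAC subrr add0r.
  case/andP=> -> /eqP fw; apply/existsP; exists 1.
  by rewrite scale1r -fw.
have -> : \pr_(w : W) miss w =
    \avg_(w : W) \avg_(w' : W) \pr_(t : F) miss (w + t *: w') :> R.
  by rewrite (avg_line_shift (fun w _ => (miss w)%:R)); apply: eq_avg => w;
    rewrite (avg_const 0).
apply: ler_avg => w; apply: ler_avg => w'.
have [p size_p kp] := polyfun_line w w' (poly_k u v).
apply: le_trans (fitH (plane_point x u v w) (lincomb2 u v w') p size_p) _.
by apply: le_pr => t; rewrite -plane_point_line /miss kp.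
Qed.

End Cone.

(** * The lines oracle *)

Section ParametrizedTest.
Variables (R : archiRealFieldType) (F : finFieldType) (m d : nat).
Local Notation V := 'rV[F]_m.
Local Notation q := (#|F|%:R : R).
Variables (f : V -> F) (P : V -> V -> {poly F}).
Hypothesis d_gt0 : (0 < d)%N.
Hypothesis famP : lines_family d P.
Hypothesis scaleP : scaling_invariant P.

(* At a base point x, the polynomials along the lines through x that agree with
   f at x define a partial function on V. *)
Lemma good_base_point (e eps : R) :
  0 < e -> e <= 1 -> 72 * d%:R <= e ^+ 5 * q ->
  0 < eps -> q^-1 <= eps ^+ 2 -> 5 * eps <= acceptance R f P ->
  exists (D : pred V) (H : V -> V -> {poly F}), [/\ lines_family d H,
    21 * eps ^+ 2 <= \pr_(x : V) D x &
    rejection R D f H <= 2 * e / eps ^+ 2 + 2 / q].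
Proof.
move=> e_gt0 e_le1 small_d eps_gt0 small_qV accept;
  have eps2_gt0 : 0 < eps ^+ 2 by rewrite exprn_gt0.
pose gam x : R := \pr_(z : V) joint_agreement f P x z.
have avg_gam : 24 * eps ^+ 2 <= avg gam.
  have := le_trans (acceptance_sqr_ge eps_gt0 accept) (acceptance_sqr_le R f famP scaleP).
  by rewrite -/(avg gam); lra.
have [k poly_k avg_error] := cone_decoding f famP d_gt0 e_gt0 e_le1 small_d.
pose M := eps ^+ 2 / (2 * e); have M_gt0 : 0 < M by rewrite divr_gt0 // mulr_gt0.
have [x base_x] := avg_ex_ge (0 : V) (fun x => gam x - M * cone_error R f P (k x) x).
have {}base_x : 21 * eps ^+ 2 <= gam x - M * cone_error R f P (k x) x.
  apply: le_trans base_x; rewrite avgB avgZ.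
  have := ler_wpM2l (ltW M_gt0) avg_error.
  have -> : M * (6 * e) = 3 * eps ^+ 2 by rewrite /M; field; rewrite gt_eqF.
  by lra.
have error_ge0 : 0 <= M * cone_error R f P (k x) x.
  apply: mulr_ge0; first exact: ltW.
  by do 2![apply: avg_ge0 => ?]; exact: pr_ge0.
have gam_le1 : gam x <= 1 := pr_le1 _ _.
have [H famH fitH] := best_fit_exists R (fun y z => cone_domain f P x y && (f y != z)) d.
exists (cone_domain f P x), H; split=> //.
  have -> : \pr_(y : V) cone_domain f P x y = gam x; last by lra.
  by rewrite -(avg_addr _ x); apply: eq_avg => y; rewrite /cone_domain addrK.
apply: le_trans (cone_rejection_le (poly_k x) famH fitH) _; rewrite lerD2r.
have : M * cone_error R f P (k x) x <= 1 by lra.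
by rewrite -ler_pdivlMl // mulr1 /M invf_div.
Qed.

Lemma exprn_le_mul_expr (z c : R) k l n : 0 <= z -> z <= c -> c <= 1 -> (k + l <= n)%N ->
  z ^+ n <= z ^+ k * c ^+ l.
Proof.
move=> z_ge0 z_le c_le1 kl; apply: (@le_trans _ _ (z ^+ (k + l))).
  by apply: ler_wiXn2l => //; exact: le_trans z_le c_le1.
by rewrite exprD ler_wpM2l ?exprn_ge0 // lerXn2r // nnegrE (le_trans z_ge0).
Qed.

Lemma dense_cone_domain (z : R) : 0 < z -> z <= 1 / 100 -> d%:R / q <= z ^+ 48 ->
  5 * (100 * z) <= acceptance R f P ->
  exists (D : pred V) (H : V -> V -> {poly F}), [/\ lines_family d H,
    21 * (100 * z) ^+ 2 <= \pr_(x : V) D x &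
    10 ^+ 13 * (rejection R D f H + q^-1) <= 441 * (100 * z) ^+ 4].
Proof.
move=> z_gt0 z_small d_le accept; have q_gt0 := card_field_gt0 R F.
have zX_gt0 k : 0 < z ^+ k by rewrite exprn_gt0.
have z48_le k l : (k + l <= 48)%N -> z ^+ 48 <= z ^+ k * (1 / 100) ^+ l.
  by apply: exprn_le_mul_expr; rewrite ?(ltW z_gt0) //; lra.
have qV_le : q^-1 <= z ^+ 48.
  by apply: le_trans d_le; rewrite ler_peMl ?ler1n // invr_ge0 ltW.
have e_le1 : z ^+ 6 <= 1 by rewrite exprn_ile1 ?(ltW z_gt0) //; lra.
have small_d : 72 * d%:R <= (z ^+ 6) ^+ 5 * q.
  rewrite -exprM -ler_pdivrMr // -mulrA; apply: (@le_trans _ _ (72 * z ^+ 48)).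
    by rewrite ler_pM2l.
  have := z48_le 30%N 1%N isT; have := zX_gt0 30%N.
  by move: (z ^+ 48) (z ^+ 30) => a b; lra.
have small_qV : q^-1 <= (100 * z) ^+ 2.
  apply: (le_trans qV_le); rewrite exprMn.
  have := z48_le 2%N 0%N isT; have := zX_gt0 2%N; rewrite expr0 mulr1.
  by move: (z ^+ 48) (z ^+ 2) => a b; lra.
have [|D [H [famH denseD rejH]]] :=
  good_base_point (zX_gt0 6%N) e_le1 small_d _ small_qV accept.
  by rewrite mulr_gt0.
exists D, H; split=> //.
have rej_eq : 2 * z ^+ 6 / (100 * z) ^+ 2 = 2 / 100 ^+ 2 * z ^+ 4 by field; rewrite gt_eqF.
have := z48_le 4%N 7%N isT; have := zX_gt0 4%N; move: rejH qV_le.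
rewrite rej_eq (exprMn 4 100 z).
by move: (rejection _ _ _ _) (z ^+ 48) (z ^+ 4) q^-1 => r a b i; lra.
Qed.

Theorem parametrized_line_test (eps : R) :
  0 < eps -> eps <= 1 -> d%:R / q <= (eps / 100) ^+ 48 -> 5 * eps <= acceptance R f P ->
  exists2 Q : V -> F, polyfun d Q & eps ^+ 2 <= \pr_(x : V) (f x == Q x).
Proof.
move=> eps_gt0 eps_le1 d_le accept; have q_gt0 := card_field_gt0 R F.
pose z := eps / 100; have eps_z : eps = 100 * z by rewrite /z; field.
rewrite -/z in d_le; clearbody z; rewrite {eps}eps_z in eps_gt0 eps_le1 accept *.
have z_gt0 : 0 < z by lra.
have z_small : z <= 1 / 100 by lra.
have zX_gt0 k : 0 < z ^+ k by rewrite exprn_gt0.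
have [D [H [famH denseD rejH]]] := dense_cone_domain z_gt0 z_small d_le accept.
set dens := \pr_(x : V) D x : R in denseD; have z2_gt0 := zX_gt0 2%N.
have z2_le : z ^+ 2 <= dens by move: denseD; rewrite exprMn; lra.
have dens_gt0 : 0 < dens := lt_le_trans z2_gt0 z2_le.
have [||Q poly_Q agree] := @partial_test R F m d D f H d_gt0 famH dens_gt0.
- rewrite -ler_pdivrMr // -mulrA; apply: (@le_trans _ _ (z ^+ 6)); last first.
    by rewrite (exprM z 2 3) lerXn2r // nnegrE ltW.
  have z48_le : z ^+ 48 <= z ^+ 6 * (1 / 100) ^+ 4.
    by apply: exprn_le_mul_expr; rewrite ?(ltW z_gt0) //; lra.
  by move: (zX_gt0 6%N) d_le z48_le; move: (z ^+ 48) (z ^+ 6) (_ / q) => a b r; lra.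
- apply: (le_trans rejH).
  rewrite -/dens (_ : 441 * _ = (21 * (100 * z) ^+ 2) ^+ 2); last by ring.
  by rewrite lerXn2r // nnegrE ?(ltW dens_gt0) // mulr_ge0 // exprn_ge0 // ltW.
exists Q => //; apply: (@le_trans _ _ (dens / 20)).
  by move: denseD; rewrite exprMn; lra.
by apply: (le_trans agree); apply: le_pr => x /andP[].
Qed.

End ParametrizedTest.

Section LinesOracle.
Variables (F : finFieldType) (m : nat).
Local Notation V := 'rV[F]_m.
Variables (f : V -> F) (P : {set V} -> V -> F).

(* The degenerate lines [line x 0] are accepted by [f]. *)
Definition extended_oracle (L : {set V}) : V -> F := if is_line L then P L else f.

Lemma extended_oracle_family d : is_lines_oracle d P ->
  exists P', [/\ lines_family d P', scaling_invariant P' &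
    forall x u, (P' x u).[0] = extended_oracle (line x u) x].
Proof.
move=> oracleP; have [|P' [famP' scaleP' evalP']] :=
  @lines_family_of_oracle _ _ d extended_oracle.
  move=> x u; rewrite /extended_oracle; case: ifP => [lineL|/negbT degenerate].
    have [a [v [p [v0 eq_line size_p evalP]]]] := oracleP _ lineL.
    by apply: (poly_on_line_eq eq_line); exists p.
  have -> : u = 0 by apply: contraNeq degenerate; exact: line_is_line.
  exists (f x)%:P => [|t]; first by rewrite size_polyC (leq_trans (leq_b1 _)).
  by rewrite scaler0 addr0 hornerC.
by exists P'; split=> // x u; rewrite evalP' scale0r addr0.
Qed.

Variable R : archiRealFieldType.

Lemma sum_directions (x : V) (G : {set V} -> R) :
  \sum_(u : V | u != 0) G (line x u) =
  (#|F|.-1)%:R * \sum_(L in lines_through x) G L.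
Proof.
rewrite (partition_big (line x) (fun L => L \in lines_through x)) /=; last first.
  by move=> u u0; apply/lines_throughP; exists u.
rewrite mulr_sumr; apply: eq_bigr => L /lines_throughP[u u0 ->].
rewrite (eq_bigr (fun=> G (line x u))); last by move=> v /andP[_ /eqP ->].
rewrite sumr_const mulr_natl; congr (_ *+ _).
rewrite -(cardC1 (0 : F)) -(card_image (f := fun c : F => c *: u)); last first.
  by move=> c c' eq_cu; apply: (line_inj (x := 0) u0); rewrite !add0r.
apply: eq_card => v; rewrite [LHS]unfold_in; apply/andP/imageP => [[v0 /eqP eq_line]|].
  have [c def_v] := line_eq_dir eq_line; exists c => //; rewrite inE.
  by apply: contraNneq v0 => c0; rewrite def_v c0 scale0r.
by case=> c; rewrite inE => c0 ->; rewrite scaler_eq0 negb_or c0 u0 line_scale.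
Qed.

Lemma card_directions (x : V) :
  #|{: V}|%:R = (#|F|.-1)%:R * #|lines_through x|%:R + 1 :> R.
Proof.
have := sum_directions x (fun=> 1); rewrite !sumr_const => <-.
rewrite -[1](mulr1n 1) -natrD addn1 (_ : #|_| = #|{: V}|.-1) ?prednK //.
  by apply/card_gt0P; exists 0.
by have := cardC1 (0 : V).
Qed.

Lemma agreement_le_acceptance (P' : V -> V -> {poly F}) :
  (forall x u, (P' x u).[0] = extended_oracle (line x u) x) ->
  agreement R f P <= acceptance R f P'.
Proof.
move=> evalP'; rewrite /agreement /acceptance avg.unlock cardsT mulrC.
rewrite ler_wpM2r ?invr_ge0 ?ler0n //; apply: ler_sum => x _.
set l := #|lines_through x|; set S := \sum_(L in _) _.
have accept0 : f x == (P' x 0).[0].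
  rewrite evalP' /extended_oracle; case: ifP => [/line_dir_neq0|//].
  by rewrite eqxx.
have sum_accept : \sum_(u : V | u != 0) (f x == (P' x u).[0])%:R = (#|F|.-1)%:R * S.
  rewrite -(sum_directions x (fun L => (f x == P L x)%:R)).
  by apply: eq_bigr => u u0; rewrite evalP' /extended_oracle line_is_line.
have S_le : S <= l%:R by rewrite -sumr_const; apply: ler_sum => L _; rewrite lern1 leq_b1.
have S_ge0 : 0 <= S by apply: sumr_ge0.
have V_gt0 : (0 : R) < #|{: V}|%:R by rewrite ltr0n; apply/card_gt0P; exists 0.
rewrite (bigD1 0) //= accept0 sum_accept ler_pdivlMr // (card_directions x) -/l.
have [l0|l_gt0] := posnP l; first by rewrite l0 invr0 !mul0r addr_ge0 // mulr_ge0.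
have -> : l%:R^-1 * S * ((#|F|.-1)%:R * l%:R + 1) = S / l%:R + (#|F|.-1)%:R * S :> R.
  by field; rewrite pnatr_eq0 -lt0n.
by rewrite lerD2r ler_pdivrMr ?ltr0n // mul1r.
Qed.

End LinesOracle.

Theorem theorem5p6 (R : realType) :
  exists C : R, 0 < C /\
  forall (F : finFieldType) (d m : nat) (eps0 : R),
    (2 <= m)%N ->
    0 < eps0 -> eps0 < 1 ->
    C * (d%:R / #|F|%:R) `^ (48%:R^-1) <= eps0 ->
    forall (eps : R), eps0 <= eps ->
    forall (f : 'rV[F]_m -> F) (P : {set 'rV[F]_m} -> 'rV[F]_m -> F),
      is_lines_oracle d P ->
      5%:R * eps <= agreement R f P ->
      exists Q : mpoly.mpoly m F, tdeg_le d Q /\ eps ^+ 2 <= pt_agreement R f Q.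
Proof.
exists 100; split=> // F d m eps0 _ eps0_gt0 _ degree_small eps eps_ge f P oracleP agree.
have eps_gt0 : 0 < eps := lt_le_trans eps0_gt0 eps_ge.
have [P' [famP' scaleP' evalP']] := extended_oracle_family f oracleP.
have accept : 5 * eps <= acceptance R f P' :=
  le_trans agree (agreement_le_acceptance R evalP').
suff [h [Q degQ hQ] close] : exists2 h : 'rV[F]_m -> F, polyfun d h &
    eps ^+ 2 <= \pr_(x : 'rV[F]_m) (f x == h x) :> R.
  exists Q; split=> //; apply: (le_trans close); rewrite pr_card /pt_agreement cardsT.
  by rewrite ler_wpM2r ?invr_ge0 // ler_nat; apply: eq_leq; apply: eq_card => x;
    rewrite !inE -hQ.
have [d0|d_gt0] := posnP d.
  by rewrite d0 in famP' *; exact: constant_test famP' eps_gt0 accept.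
apply: (parametrized_line_test d_gt0 famP' scaleP' eps_gt0 _ _ accept).
  have : acceptance R f P' <= 1 by apply: (avg_le 0) => x; exact: pr_le1.
  by lra.
set x := d%:R / #|F|%:R in degree_small *; have x_ge0 : 0 <= x by rewrite divr_ge0.
have -> : x = (x `^ 48%:R^-1) ^+ 48.
  by rewrite -powR_mulrn ?powR_ge0 // -powRrM mulVf ?powRr1 // pnatr_eq0.
rewrite lerXn2r ?nnegrE ?powR_ge0 ?divr_ge0 ?(ltW eps_gt0) //.
by rewrite ler_pdivlMr // mulrC (le_trans degree_small).
Qed.
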